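(* Let $\varphi(z)$ be a complex-valued function in the Schur-Agler class on the unit ball $\mathbb{B}_d$. For each $z\in\mathbb{B}_d$ and any nonnegative integers $n_1,\dots,n_d$ which are not all zero, $$\left|\frac{\partial^{n}\varphi}{\partial z_d^{n_d}\cdots\partial z_1^{n_1}}(z)\right|\le (n-1)!\;\frac{1-|\varphi(z)|^2}{(1-\|z\|_2^2)(1-\|z\|_2)^{n-1}}\;\sum_{j=1}^d n_j\sqrt{1-\|\hat z_j\|_2^2},$$ where $n=n_1+\cdots+n_d$.
   Context: Here $d\ge 1$ and $\mathbb{B}_d=\{(z_1,\dots,z_d)\in\mathbb{C}^d:|z_1|^2+\cdots+|z_d|^2<1\}$. For $z,w\in\mathbb{C}^d$, $\langle z,w\rangle=z_1\bar w_1+\cdots+z_d\bar w_d$ and $\|z\|_2=\langle z,z\rangle^{1/2}$. For $z=(z_1,\dots,z_d)$, $\hat z_j=(z_1,\dots,z_{j-1},0,z_{j+1},\dots,z_d)$ denotes $z$ with its $j$-th coordinate replaced by $0$. The Arveson space is the Hilbert space of analytic functions on $\mathbb{B}_d$ with reproducing kernel $k(w,z)=1/(1-\langle z,w\rangle)$. The Schur-Agler class on the unit ball is the class of contractive multipliers of the Arveson space, i.e. analytic functions $\varphi$ on $\mathbb{B}_d$ such that multiplication by $\varphi$ is an everywhere defined operator on the Arveson space of norm at most one. Equivalently, the kernel $[1-\varphi(z)\overline{\varphi(w)}]/(1-\langle z,w\rangle)$ is nonnegative on $\mathbb{B}_d$, that is, $\sum_{j,k=1}^m \frac{1-\varphi(z^{(k)})\overline{\varphi(z^{(j)})}}{1-\langle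 z^{(k)},z^{(j)}\rangle}c_j\bar c_k\ge 0$ for any positive integer $m$, any points $z^{(1)},\dots,z^{(m)}\in\mathbb{B}_d$ and any complex numbers $c_1,\dots,c_m$. *)

(* Defs.v *)
From HB Require Import structures.
From mathcomp Require Import all_boot all_order all_algebra.
From mathcomp Require Import sesquilinear.
From mathcomp Require Import complex.
From mathcomp Require Import all_classical all_reals all_analysis.

Set Implicit Arguments.
Unset Strict Implicit.
Unset Printing Implicit Defensive.

Import Order.TTheory GRing.Theory Num.Theory.
Import numFieldNormedType.Exports.

Local Open Scope classical_set_scope.
Local Open Scope ring_scope.

(* Stated at [numClosedFieldType] so that the generic topology and normed-module
   structure of number fields applies to the complex numbers.  An inequality
   [x <= y] in this type says that [y - x] is a nonnegative real. *)
Definition Cplx (R : realType) : numClosedFieldType := R[i].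

Definition inner (R : realType) (d : nat) (z w : 'rV[Cplx R]_d) : Cplx R :=
  \sum_(j < d) z 0 j * (w 0 j)^*.

(* The norm [`|z|] of the library on ['rV_d] is the sup norm. *)
Definition norm2 (R : realType) (d : nat) (z : 'rV[Cplx R]_d) : Cplx R :=
  sqrtC (inner z z).

Definition unit_ball (R : realType) (d : nat) : set 'rV[Cplx R]_d :=
  [set z | \sum_(j < d) `|z 0 j| ^+ 2 < 1].

Definition hat (R : realType) (d : nat) (z : 'rV[Cplx R]_d) (j : 'I_d) :
    'rV[Cplx R]_d :=
  \row_(i < d) (if i == j then 0 else z 0 i).

(* Functions on the ball are total functions whose values outside the ball are
   irrelevant.  The scalar field is the complex one, so [differentiable] is
   Frechet differentiability over the complex numbers. *)
Definition analytic_on_ball (R : realType) (d : nat)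
    (f : 'rV[Cplx R]_d -> Cplx R) : Prop :=
  forall z, unit_ball z -> differentiable f z.

(* A Hilbert space is a complete normed space whose norm comes from an inner
   product, linear in its first argument.  Its vectors are functions on the
   ball through [av_eval], which is injective modulo values outside the ball.
   The kernel determines the space up to an isometry commuting with [av_eval]. *)
Record arveson_space (R : realType) (d : nat) := ArvesonSpace {
  av_space :> completeNormedModType (Cplx R) ;
  av_dot : {dot av_space for Num.conj} ;
  av_normE : forall f : av_space, `|f| ^+ 2 = av_dot f f ;
  av_eval : av_space -> 'rV[Cplx R]_d -> Cplx R ;
  av_eval_linear : forall (a : Cplx R) (f g : av_space) z, unit_ball z ->
    av_eval (a *: f + g) z = a * av_eval f z + av_eval g z ;
  av_eval_inj : forall f g : av_space,
    (forall z, unit_ball z -> av_eval f z = av_eval g z) -> f = g ;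
  av_analytic : forall f : av_space, analytic_on_ball (av_eval f) ;
  av_reproducing : forall w, unit_ball w ->
    exists2 kw : av_space,
      forall z, unit_ball z -> av_eval kw z = (1 - inner z w)^-1
      & forall f : av_space, av_dot f kw = av_eval f w
}.

Definition contractive_multiplier (R : realType) (d : nat)
    (H : arveson_space R d) (phi : 'rV[Cplx R]_d -> Cplx R) : Prop :=
  forall f : H, exists2 g : H,
    forall z, unit_ball z -> av_eval g z = phi z * av_eval f z
    & `|g| <= `|f|.

Definition schur_agler (R : realType) (d : nat)
    (phi : 'rV[Cplx R]_d -> Cplx R) : Prop :=
  analytic_on_ball phi /\
  exists H : arveson_space R d, contractive_multiplier H phi.

Definition partial (R : realType) (d : nat) (j : 'I_d)
    (f : 'rV[Cplx R]_d -> Cplx R) : 'rV[Cplx R]_d -> Cplx R :=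
  fun z => 'D_(delta_mx 0 j) f z.

(* The derivatives in the first coordinate are taken first. *)
Definition mixed_partial (R : realType) (d : nat) (nu : 'I_d -> nat)
    (f : 'rV[Cplx R]_d -> Cplx R) : 'rV[Cplx R]_d -> Cplx R :=
  foldl (fun g j => iter (nu j) (@partial R d j) g) f (enum 'I_d).

(* Main.v *)
Require Import Defs.
From HB Require Import structures.
From mathcomp Require Import all_boot all_order all_algebra.
From mathcomp Require Import sesquilinear.
From mathcomp Require Import complex.
From mathcomp Require Import all_classical all_reals all_analysis.
From mathcomp Require Import ring.

Set Implicit Arguments.
Unset Strict Implicit.
Unset Printing Implicit Defensive.

Import Order.TTheory GRing.Theory Num.Theory.
Import numFieldNormedType.Exports.

Local Open Scope classical_set_scope.
Local Open Scope ring_scope.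

(* Nonnegativity of the kernel [(1 - phi(z) phi(w)^* ) / (1 - <z, w>)] provides
   vectors [gamma(w)] in a semi-inner product space with
     [1 + sum_j <w_j^* gamma(w), w'_j^* gamma(w')>
        = phi(w)^* phi(w') + <gamma(w), gamma(w')>],
   so [(1, (w_j^* gamma(w))_j) |-> (phi(w)^*, gamma(w))] is isometric.  It stays
   isometric on iterated difference quotients: if [g_s], [f_s] are those of
   [gamma], [phi^*] at [z] along a list [s] of steps and [y] collects the terms
   in which the Leibniz rule differentiates a coordinate, then
     [(0, (z_j^* g_s + y_j)_j) |-> (f_s, g_s)],
   modulo multiples of the pair at [z] itself.  Comparing norms gives
   [(1 - |z|) |g_s| <= sum_i |g_(s without i)|], hence [|g_s|] is at most
   [|s|! |gamma| / (1 - |z|)^|s|], and, optimising over the multiple,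
     [|f_s|^2 <= (1 - |phi|^2) <(I - Z^* Z)^-1 y, y>],  [Z = (z_1, ..., z_d)].
   Together these bound the difference quotients of [phi] by the asserted
   quantity.  Uniform local bounds on all difference quotients also make the
   iterated partial derivatives exist as limits of difference quotients, with
   no recourse to Cauchy's integral formula. *)

(** * Semi-inner products *)

Section SemiInner.
Variables (C : numClosedFieldType).
Implicit Types (V : lmodType C).

Definition hermitian_form V (B : V -> V -> C) : Prop :=
  (forall a x y z, B (a *: x + y) z = a * B x z + B y z) /\
  (forall x y, B y x = (B x y)^*).

(** The empty set qualifies; zero belongs only once a member is known, so later results take such a
    member as witness. *)
Definition linear_set V (D : V -> Prop) : Prop :=
  forall a x y, D x -> D y -> D (a *: x + y).

(** Positivity is asked only on [D]: the form used later is a difference of two inner products,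
    nonnegative on the graph of an adjoint but not on the whole product space. *)
Definition semi_inner V (D : V -> Prop) (B : V -> V -> C) : Prop :=
  [/\ hermitian_form B, linear_set D & forall x, D x -> 0 <= B x x].

Section Herm.
Variables (V : lmodType C) (B : V -> V -> C) (hB : hermitian_form B).

Lemma hformPl a x y z : B (a *: x + y) z = a * B x z + B y z.
Proof. by case: hB => H _; exact: H. Qed.

Lemma hformC x y : B y x = (B x y)^*.
Proof. by case: hB => _ H; exact: H. Qed.

Lemma hformDl x y z : B (x + y) z = B x z + B y z.
Proof. by rewrite -[x]scale1r hformPl mul1r scale1r. Qed.

Lemma hform0l z : B 0 z = 0.
Proof. by apply: (addrI (B 0 z)); rewrite -hformDl !addr0. Qed.

Lemma hformZl a x z : B (a *: x) z = a * B x z.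
Proof. by rewrite -[a *: x]addr0 hformPl hform0l addr0. Qed.

Lemma hformBl x y z : B (x - y) z = B x z - B y z.
Proof. by rewrite -scaleN1r hformDl hformZl mulN1r. Qed.

Lemma hformDr x y z : B z (x + y) = B z x + B z y.
Proof. by rewrite hformC hformDl rmorphD /= -!hformC. Qed.

Lemma hformZr a x z : B z (a *: x) = a^* * B z x.
Proof. by rewrite hformC hformZl rmorphM /= -hformC. Qed.

Lemma hformBr x y z : B z (x - y) = B z x - B z y.
Proof. by rewrite hformC hformBl rmorphB /= -!hformC. Qed.

Lemma hform0r z : B z 0 = 0.
Proof. by rewrite hformC hform0l rmorph0. Qed.

Lemma hform_suml I (r : seq I) (P : pred I) (F : I -> V) z :
  B (\sum_(i <- r | P i) F i) z = \sum_(i <- r | P i) B (F i) z.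
Proof.
by apply: (big_morph (fun x => B x z)) => [x y|]; rewrite (hformDl, hform0l).
Qed.

Lemma hform_sumr I (r : seq I) (P : pred I) (F : I -> V) z :
  B z (\sum_(i <- r | P i) F i) = \sum_(i <- r | P i) B z (F i).
Proof.
by apply: (big_morph (fun x => B z x)) => [x y|]; rewrite (hformDr, hform0r).
Qed.

End Herm.

Definition seminorm V (B : V -> V -> C) (x : V) : C := sqrtC (B x x).

Section Semi.
Variables (V : lmodType C) (D : V -> Prop) (B : V -> V -> C).
Hypothesis hB : semi_inner D B.

Let hf : hermitian_form B. Proof. by case: hB. Qed.

Lemma semi_inner_ge0 x : D x -> 0 <= B x x.
Proof. by case: hB => _ _; apply. Qed.

Lemma semi_innerP a x y : D x -> D y -> D (a *: x + y).
Proof. by case: hB => _ H _; exact: H. Qed.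

Lemma semi_inner0 x : D x -> D 0.
Proof. by move=> Dx; rewrite -(addNr x) -scaleN1r; exact: semi_innerP. Qed.

Lemma semi_innerD x y : D x -> D y -> D (x + y).
Proof. by move=> Dx Dy; rewrite -[x]scale1r; exact: semi_innerP. Qed.

Lemma semi_innerZ a x : D x -> D (a *: x).
Proof.
by move=> Dx; rewrite -[_ *: _]addr0; apply: semi_innerP => //; exact: semi_inner0 Dx.
Qed.

Lemma semi_innerB x y : D x -> D y -> D (x - y).
Proof. by move=> Dx Dy; rewrite -scaleN1r addrC; exact: semi_innerP. Qed.

Lemma cauchy_schwarz x y : D x -> D y -> `|B x y| ^+ 2 <= B x x * B y y.
Proof.
move=> Dx Dy; have x0 := semi_inner_ge0 Dx; have y0 := semi_inner_ge0 Dy.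
have [y_eq0|y_neq0] := eqVneq (B y y) 0.
  rewrite y_eq0 mulr0; apply: contraT => h.
  have b_neq0 : B x y != 0 by apply: contra h => /eqP->; rewrite normr0 expr0n.
  have n_neq0 : `|B x y| ^+ 2 != 0 by rewrite expf_neq0 // normr_eq0.
  (* When [B y y = 0], adding [- (t * B x y)] times [y] to [x] changes [B x x] by [-2 t |B x y|^2];
     this [t] makes the result [- (B x x + 2)], which is negative. *)
  pose t := (B x x + 1) / `|B x y| ^+ 2.
  have t_real : t^* = t.
    apply: CrealP; rewrite rpredM ?rpredV ?rpredX ?normr_real //.
    by rewrite rpredD ?rpred1 // ger0_real.
  have t_def : t * `|B x y| ^+ 2 = B x x + 1 by rewrite divfK.
  move: t t_real t_def => t t_real t_def.
  have := semi_inner_ge0 (semi_innerP (- (t * B x y)) Dy Dx).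
  rewrite !(hformPl hf) !(hformDr hf) !(hformZr hf) y_eq0 mulr0 add0r.
  rewrite (hformC hf x y) !rmorphN !rmorphM /= t_real.
  have -> : - (t * B x y) * (B x y)^* + (- (t * (B x y)^*) * B x y + B x x)
     = B x x - (t * `|B x y| ^+ 2) - (t * `|B x y| ^+ 2) by rewrite normCK; ring.
  rewrite t_def => h1; have : 0 <= - (B x x + 2).
    by move: h1; have -> : B x x - (B x x + 1) - (B x x + 1) = - (B x x + 2) by ring.
  by rewrite oppr_ge0 lt_geF // ltr_wpDl.
have y_gt0 : 0 < B y y by rewrite lt_def y_neq0.
(* The vector [B y y *: x - B x y *: y] is orthogonal to [y]; its square is [B y y] times the gap in
   the inequality. *)
have := semi_inner_ge0 (semi_innerP (B y y) Dx (semi_innerZ (- B x y) Dy)).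
rewrite !(hformPl hf) !(hformDr hf) !(hformZr hf) !(hformZl hf).
rewrite (hformC hf x y) !rmorphN /= (geC0_conj y0).
have -> : B y y * (B y y * B x x + - (B x y)^* * B x y) +
   (B y y * (- B x y * (B x y)^*) + - (B x y)^* * (- B x y * B y y))
   = B y y * (B x x * B y y - `|B x y| ^+ 2) by rewrite normCK; ring.
by rewrite pmulr_rge0 // subr_ge0.
Qed.

Lemma seminorm_ge0 x : D x -> 0 <= seminorm B x.
Proof. by move=> Dx; rewrite sqrtC_ge0 semi_inner_ge0. Qed.

Lemma seminorm_sqr x : seminorm B x ^+ 2 = B x x.
Proof. exact: sqrtCK. Qed.

Lemma le_seminorm_hform x y : D x -> D y ->
  `|B x y| <= seminorm B x * seminorm B y.
Proof.
move=> Dx Dy; rewrite -(@ler_pXn2r _ 2) ?nnegrE ?mulr_ge0 ?seminorm_ge0 //.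
by rewrite exprMn !seminorm_sqr cauchy_schwarz.
Qed.

Lemma seminormD x y : D x -> D y ->
  seminorm B (x + y) <= seminorm B x + seminorm B y.
Proof.
move=> Dx Dy; have Dxy := semi_innerD Dx Dy.
rewrite -(@ler_pXn2r _ 2) ?nnegrE ?addr_ge0 ?seminorm_ge0 //.
rewrite seminorm_sqr -[leLHS]ger0_norm ?semi_inner_ge0 //.
rewrite (hformDl hf) !(hformDr hf) sqrrD !seminorm_sqr.
have h := le_seminorm_hform Dx Dy.
rewrite (hformC hf x y).
apply: (le_trans (ler_normD _ _)).
apply: (le_trans (lerD (ler_normD _ _) (ler_normD _ _))).
rewrite norm_conjC (ger0_norm (semi_inner_ge0 Dx)) (ger0_norm (semi_inner_ge0 Dy)).
by rewrite addrA lerD2r -addrA lerD2l mulr2n lerD.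
Qed.

Lemma seminorm_sum I (r : seq I) (P : pred I) (F : I -> V) x0 : D x0 ->
  (forall i, P i -> D (F i)) ->
  D (\sum_(i <- r | P i) F i) /\
  seminorm B (\sum_(i <- r | P i) F i) <= \sum_(i <- r | P i) seminorm B (F i).
Proof.
move=> Dx0 DF.
apply: (big_ind2 (fun x t => D x /\ seminorm B x <= t)) => [|x s y t [Dx ?] [Dy ?]|i /DF Di].
- by split; [exact: semi_inner0 Dx0|rewrite /seminorm (hform0l hf) sqrtC0].
- split; first exact: semi_innerD.
  by apply: (le_trans (seminormD Dx Dy)); exact: lerD.
- by [].
Qed.

End Semi.
End SemiInner.

(** * The isometry estimates *)

Section Tuples.
Variables (C : numClosedFieldType) (V : lmodType C) (D : V -> Prop).
Variables (B : V -> V -> C) (d : nat).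
Hypothesis hB : semi_inner D B.
Implicit Types (x y : {ffun 'I_d -> V}) (z : 'rV[C]_d).

Definition tuple_set y : Prop := forall j, D (y j).

Definition single (j : 'I_d) (v : V) : {ffun 'I_d -> V} :=
  [ffun k => if k == j then v else 0].

Definition sqnorm z : C := \sum_j `|z 0 j| ^+ 2.

Definition comb z y : V := \sum_j z 0 j *: y j.

Definition row_form x y : C := \sum_j B (x j) (y j).

(* [<(I - Z^* Z)^-1 x, y>] for the row [Z = (z_1 I, ..., z_d I)] *)
Definition defect_form z x y : C :=
  row_form x y + B (comb z x) (comb z y) / (1 - sqnorm z).

Let hf : hermitian_form B. Proof. by case: hB. Qed.

Lemma sqnorm_ge0 z : 0 <= sqnorm z.
Proof. by apply: sumr_ge0 => j _; rewrite exprn_ge0. Qed.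

Lemma tuple_set_linear : linear_set tuple_set.
Proof. by move=> a x y Dx Dy j; rewrite !ffunE; apply: (semi_innerP hB). Qed.

Lemma row_form_hermitian : hermitian_form row_form.
Proof.
split=> [a x y z|x y]; rewrite /row_form.
  by rewrite mulr_sumr -big_split /=; apply: eq_bigr => j _; rewrite !ffunE (hformPl hf).
by rewrite rmorph_sum; apply: eq_bigr => j _; rewrite /= -(hformC hf).
Qed.

Lemma combP z a x y : comb z (a *: x + y) = a *: comb z x + comb z y.
Proof.
rewrite /comb scaler_sumr -big_split /=; apply: eq_bigr => j _.
by rewrite !ffunE scalerDr !scalerA mulrC.
Qed.

Lemma comb_in z y v : D v -> tuple_set y -> D (comb z y).
Proof.
move=> Dv Dy; apply: (big_ind D) => [|u w|j _]; first exact: (semi_inner0 hB Dv).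
  exact: (semi_innerD hB).
exact: (semi_innerZ hB).
Qed.

Lemma row_form_semi : semi_inner tuple_set row_form.
Proof.
split; [exact: row_form_hermitian|exact: tuple_set_linear|].
by move=> x Dx; apply: sumr_ge0 => j _; exact: (semi_inner_ge0 hB).
Qed.

Lemma defect_form_semi z v : D v -> sqnorm z < 1 ->
  semi_inner tuple_set (defect_form z).
Proof.
move=> Dv z_lt1; split; [|exact: tuple_set_linear|].
  split=> [a x y w|x y]; rewrite /defect_form.
    by rewrite (hformPl row_form_hermitian) combP (hformPl hf); ring.
  rewrite rmorphD rmorphM /= -(hformC row_form_hermitian) -(hformC hf).
  congr (_ + _ * _); rewrite geC0_conj // invr_ge0 subr_ge0.
  exact: ltW.
move=> x Dx; rewrite addr_ge0 ?(semi_inner_ge0 row_form_semi) //.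
apply: divr_ge0; last by rewrite subr_ge0 ltW.
by apply: (semi_inner_ge0 hB); exact: (comb_in _ Dv).
Qed.

Lemma single_in j v : D v -> tuple_set (single j v).
Proof. by move=> Dv k; rewrite ffunE; case: eqP => // _; exact: (semi_inner0 hB Dv). Qed.

Lemma row_form_single j v : row_form (single j v) (single j v) = B v v.
Proof.
rewrite /row_form (bigD1 j) //= !ffunE eqxx big1 ?addr0 // => k /negPf kj.
by rewrite !ffunE kj (hform0l hf).
Qed.

Lemma comb_single z j v : comb z (single j v) = z 0 j *: v.
Proof.
rewrite /comb (bigD1 j) //= !ffunE eqxx big1 ?addr0 // => k /negPf kj.
by rewrite !ffunE kj scaler0.
Qed.

(** The weight equals [(1 - |hat z_j|^2) / (1 - |z|^2)], the source of the square roots in the final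
    bound. *)
Lemma defect_form_single z j v : defect_form z (single j v) (single j v) =
  B v v * (1 + `|z 0 j| ^+ 2 / (1 - sqnorm z)).
Proof.
rewrite /defect_form row_form_single comb_single (hformZl hf) (hformZr hf) normCK.
by ring.
Qed.

Section Estimate.
Variables (z : 'rV[C]_d) (g u : V) (y : {ffun 'I_d -> V}) (c p : C).
Hypotheses (z_lt1 : sqnorm z < 1) (Dg : D g) (Du : D u) (Dy : tuple_set y).
(** Intended values: [g] is [gamma(z)], [p] is [phi(z)^*], [u] and [c] are quotients of [gamma] and
    [phi^*], and [y] collects the Leibniz terms. The scalar [s] is free because multiples of the
    pair at [z] may be subtracted. *)
Hypothesis colligation : forall s : C,
  `|c - s * p| ^+ 2 + B (u - s *: g) (u - s *: g) =
  `|s| ^+ 2 + \sum_j B ((z 0 j)^* *: (u - s *: g) + y j)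
                       ((z 0 j)^* *: (u - s *: g) + y j).

(** Take [s = 0] and drop [|c|^2]: then [|u|] is at most the norm of the row [z_j^* u + y_j], and
    the row [z_j^* u] has norm [|z| |u|]. The triangle inequality concludes. *)
Lemma row_norm_bound :
  (1 - sqrtC (sqnorm z)) * seminorm B u <= seminorm row_form y.
Proof.
pose x : {ffun 'I_d -> V} := [ffun j => (z 0 j)^* *: u].
have Dx : tuple_set x by move=> j; rewrite ffunE; exact: (semi_innerZ hB).
have -> : (1 - sqrtC (sqnorm z)) * seminorm B u =
          seminorm B u - seminorm row_form x.
  rewrite mulrBl mul1r; congr (_ - _); rewrite /seminorm /row_form.
  rewrite -sqrtCM ?qualifE /= ?sqnorm_ge0 ?(semi_inner_ge0 hB) //.
  congr sqrtC; rewrite mulr_suml; apply: eq_bigr => j _.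
  by rewrite !ffunE (hformZl hf) (hformZr hf) conjCK normCKC mulrA.
rewrite lerBlDl; apply: le_trans (seminormD row_form_semi Dx Dy).
rewrite /seminorm ler_sqrtC ?qualifE /= ?(semi_inner_ge0 hB) //; last first.
  by rewrite (semi_inner_ge0 row_form_semi) //; exact: (semi_innerD row_form_semi).
have := colligation 0; rewrite scale0r mul0r !subr0 normr0 expr0n add0r.
rewrite /row_form => e; apply: (@le_trans _ _ (`|c| ^+ 2 + B u u)).
  by rewrite lerDr exprn_ge0.
by rewrite e le_eqVlt; apply/orP; left; apply/eqP/eq_bigr => j _; rewrite !ffunE.
Qed.

(** Completing the square in [w]: the gap is [1 - |z|^2] times the square of
    [w - comb z y / (1 - |z|^2)]. *)
Lemma defect_completed_square w : D w ->
  \sum_j B ((z 0 j)^* *: w + y j) ((z 0 j)^* *: w + y j) - B w w <=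
  defect_form z y y.
Proof.
move=> Dw; have z_gt0 : 0 < 1 - sqnorm z by rewrite subr_gt0.
have zK : (1 - sqnorm z)^* = 1 - sqnorm z by rewrite geC0_conj // ltW.
pose t := (1 - sqnorm z)^-1; have tK : t^* = t by rewrite geC0_conj // invr_ge0 ltW.
have Dwy : D (w - t *: comb z y).
  by apply: (semi_innerB hB) => //; apply: (semi_innerZ hB); exact: (comb_in _ Dw).
rewrite -subr_ge0.
have -> : defect_form z y y - (\sum_j B ((z 0 j)^* *: w + y j)
     ((z 0 j)^* *: w + y j) - B w w) =
   (1 - sqnorm z) * B (w - t *: comb z y) (w - t *: comb z y).
  have -> : \sum_j B ((z 0 j)^* *: w + y j) ((z 0 j)^* *: w + y j) =
    sqnorm z * B w w + B w (comb z y) + B (comb z y) w + row_form y y.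
    rewrite /sqnorm mulr_suml /comb (hform_sumr hf) (hform_suml hf) /row_form.
    rewrite -!big_split /=; apply: eq_bigr => j _.
    rewrite !(hformDl hf) !(hformDr hf) !(hformZl hf) !(hformZr hf) conjCK normCKC.
    by ring.
  rewrite /defect_form !(hformBl hf) !(hformBr hf) !(hformZl hf) !(hformZr hf) tK /t.
  by field; rewrite gt_eqF.
by rewrite mulr_ge0 ?(ltW z_gt0) // (semi_inner_ge0 hB).
Qed.

(* The optimal multiple is [s = - t c p^*] with [t = 1 / (1 - |p|^2)]. *)
Lemma coefficient_bound : `|p| <= 1 ->
  `|c| ^+ 2 <= (1 - `|p| ^+ 2) * defect_form z y y.
Proof.
move=> p_le1; set Y := defect_form z y y.
have Y_ge0 : 0 <= Y by rewrite (semi_inner_ge0 (defect_form_semi Du z_lt1)).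
have P_le1 : `|p| ^+ 2 <= 1 by rewrite expr_le1.
(* Kept for every [t >= 0], since the optimal [t] is infinite when [|p| = 1]. *)
have key t : 0 <= t ->
    `|c| ^+ 2 * ((1 + t * `|p| ^+ 2) ^+ 2 - t ^+ 2 * `|p| ^+ 2) <= Y.
  move=> t_ge0; pose s := - (t * c * p^*).
  have Dw : D (u - s *: g) by apply: (semi_innerB hB) => //; exact: (semi_innerZ hB).
  apply: le_trans (defect_completed_square Dw).
  rewrite -(lerD2r (B (u - s *: g) (u - s *: g))) subrK -(lerD2l (`|s| ^+ 2)).
  rewrite -colligation addrA lerD2r le_eqVlt; apply/orP; left; apply/eqP.
  have -> : c - s * p = c * (1 + t * `|p| ^+ 2) by rewrite normCK /s; ring.
  have -> : `|s| ^+ 2 = `|c| ^+ 2 * (t ^+ 2 * `|p| ^+ 2).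
    by rewrite normrN !normrM norm_conjC (ger0_norm t_ge0); ring.
  rewrite normrM (@ger0_norm _ (1 + _)); last first.
    by rewrite addr_ge0 // mulr_ge0 // exprn_ge0.
  by ring.
have [p1|p_neq1] := eqVneq (`|p| ^+ 2) 1.
  rewrite p1 subrr mul0r; apply: contraT => c_gt0.
  have {c_gt0} c_gt0 : 0 < `|c| ^+ 2.
    rewrite lt_def exprn_ge0 // andbT.
    by apply: contra c_gt0 => /eqP->.
  (* For [|p| = 1] the bound reads [|c|^2 (1 + 2t) <= Y], which this [t] violates as [c] is
     nonzero. *)
  have := key (Y / `|c| ^+ 2) (divr_ge0 Y_ge0 (ltW c_gt0)).
  rewrite p1 !mulr1.
  have -> : `|c| ^+ 2 * ((1 + Y / `|c| ^+ 2) ^+ 2 - (Y / `|c| ^+ 2) ^+ 2) =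
    `|c| ^+ 2 + Y + Y by field; apply: contraTneq c_gt0 => ->; rewrite expr0n ltxx.
  by rewrite gerDr => c_le0; have := lt_le_trans (ltr_wpDr Y_ge0 c_gt0) c_le0; rewrite ltxx.
have p_gt0 : 0 < 1 - `|p| ^+ 2 by rewrite subr_gt0 lt_def P_le1 eq_sym p_neq1.
have := key ((1 - `|p| ^+ 2)^-1); rewrite invr_ge0 ltW // => /(_ isT).
have -> : `|c| ^+ 2 * ((1 + (1 - `|p| ^+ 2)^-1 * `|p| ^+ 2) ^+ 2 -
    (1 - `|p| ^+ 2)^-1 ^+ 2 * `|p| ^+ 2) = `|c| ^+ 2 / (1 - `|p| ^+ 2).
  by field; rewrite gt_eqF.
by rewrite ler_pdivrMr // mulrC.
Qed.

End Estimate.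
End Tuples.

(** * Iterated difference quotients *)

Section Differences.
Variables (C : numClosedFieldType) (d : nat).
Local Notation step := ('I_d * C)%type.
Implicit Types (p : step) (s : seq step) (r : step * seq step) (z w : 'rV[C]_d).

Definition move p z : 'rV[C]_d := p.2 *: delta_mx 0 p.1 + z.

Lemma moveC p p' z : move p (move p' z) = move p' (move p z).
Proof. by rewrite /move addrCA. Qed.

(* The scalar map [k] is the identity for holomorphic functions and the
   conjugation for antiholomorphic ones. *)
Definition quot (k : C -> C) (V : lmodType C) p (f : 'rV[C]_d -> V) z : V :=
  (k p.2)^-1 *: (f (move p z) - f z).

Definition quots k (V : lmodType C) s (f : 'rV[C]_d -> V) : 'rV[C]_d -> V :=
  foldr (@quot k V) f s.

Lemma quotC k (V : lmodType C) p p' (f : 'rV[C]_d -> V) z :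
  quot k p (quot k p' f) z = quot k p' (quot k p f) z.
Proof.
rewrite /quot -!scalerBr !scalerA [in RHS]mulrC moveC; congr (_ *: _).
by rewrite !opprB addrACA [in RHS]addrACA; congr (_ + _); rewrite addrC.
Qed.

Lemma eq_quot k (V : lmodType C) p (f g : 'rV[C]_d -> V) z :
  (forall w, f w = g w) -> quot k p f z = quot k p g z.
Proof. by move=> fg; rewrite /quot !fg. Qed.

(** A bound on second quotients thus controls the change of a first quotient when its step is
    halved. *)
Lemma quot_double j h (f : 'rV[C]_d -> C^o) z : h != 0 ->
  quot id (j, h + h) f z - quot id (j, h) f z =
  h / 2 * quot id (j, h) (quot id (j, h) f) z.
Proof.
move=> h0; rewrite /quot /= -/(move _ _).
have -> : move (j, h + h) z = move (j, h) (move (j, h) z).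
  by rewrite /move /= scalerDl addrA.
have hh : h + h != 0 by rewrite -mulr2n -mulr_natl mulf_neq0 ?pnatr_eq0.
move: (f _) (f _) (f z) => u v w; rewrite /GRing.scale /=.
by field; rewrite h0 hh.
Qed.

(** All vertices of the parallelepiped spanned at [z] by the steps lie in [G]; these are the points
    where an iterated quotient evaluates its function. *)
Fixpoint reach (G : 'rV[C]_d -> Prop) s z : Prop :=
  if s is p :: s' then reach G s' z /\ reach G s' (move p z) else G z.

(* All ways to remove one step from the list. *)
Fixpoint picks s : seq (step * seq step) :=
  if s is p :: s' then (p, s') :: [seq (r.1, p :: r.2) | r <- picks s'] else [::].

Lemma reach_base (G : 'rV[C]_d -> Prop) s z : reach G s z -> G z.
Proof. by elim: s z => [//|p s IH] z [/IH]. Qed.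

Lemma reach_picks G s z r : r \in picks s -> reach G s z ->
  reach G r.2 (move r.1 z).
Proof.
elim: s z r => [//|p s IH] z r /=; rewrite inE => /orP[/eqP-> [] //|].
case/mapP => t ts -> /= [Gz Gpz]; split; first exact: IH.
by rewrite moveC; exact: IH.
Qed.

Lemma picks_perm s r : r \in picks s -> perm_eq (r.1 :: r.2) s.
Proof.
elim: s r => [//|p s IH] r /=; rewrite inE => /orP[/eqP-> //|].
case/mapP => t /IH ts -> /=; apply/permP => a.
by move/permP: ts => /(_ a) /= <-; rewrite addnCA.
Qed.

Lemma map_picks s : [seq r.1 | r <- picks s] = s.
Proof. by elim: s => //= p s IH; rewrite -map_comp -[in RHS]IH. Qed.

Section Closure.
Variables (k : C -> C) (V : lmodType C) (f : 'rV[C]_d -> V).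
Variable (G : 'rV[C]_d -> Prop).

Lemma quots_closed (P : V -> Prop) s z :
  (forall a x y, P x -> P y -> P (a *: (x - y))) ->
  (forall w, G w -> P (f w)) -> reach G s z -> P (quots k s f z).
Proof.
move=> PP Pf; elim: s z => [|p s IH] z /=; first exact: Pf.
by case=> /IH ? /IH ?; exact: PP.
Qed.

Lemma quots_comp (k' : C -> C) (V' : lmodType C) (L : V -> V') s z :
  (forall a x y, L ((k a)^-1 *: (x - y)) = (k' a)^-1 *: (L x - L y)) ->
  L (quots k s f z) = quots k' s (L \o f) z.
Proof. by move=> hL; elim: s z => [//|p s IH] z /=; rewrite hL !IH. Qed.

Lemma eq_quots (g : 'rV[C]_d -> V) s z : (forall w, f w = g w) ->
  quots k s f z = quots k s g z.
Proof. by move=> fg; elim: s z => [//|p s IH] z /=; rewrite /quot !IH. Qed.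

End Closure.

Lemma quots_cst k (V : lmodType C) (c : V) s z :
  quots k s (fun=> c) z = if s is [::] then c else 0.
Proof.
elim: s z => [//|p s IH] z /=; rewrite /quot !IH.
by case: s {IH} => *; rewrite ?subrr ?scaler0.
Qed.

Definition nonzero_steps s : bool := all (fun p => p.2 != 0) s.

(* Leibniz rule: the term differentiating the coordinate along a step is
   evaluated at the base point translated by that step. *)
Lemma quots_coord (V : lmodType C) (f : 'rV[C]_d -> V) j s z :
  nonzero_steps s ->
  quots Num.conj s (fun w => (w 0 j)^* *: f w) z =
  (z 0 j)^* *: quots Num.conj s f z +
  \sum_(r <- picks s | r.1.1 == j) quots Num.conj r.2 f (move r.1 z).
Proof.
elim: s z => [|p s IH] z /=; first by rewrite big_nil addr0.
case/andP=> p_neq0 s_neq0; rewrite big_cons big_map /= {1}/quot !IH //.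
have -> : \sum_(r <- picks s | r.1.1 == j)
    quot Num.conj p (quots Num.conj r.2 f) (move r.1 z) =
  ((p.2)^*)^-1 *: (\sum_(r <- picks s | r.1.1 == j) quots Num.conj r.2 f (move r.1 (move p z))
  - \sum_(r <- picks s | r.1.1 == j) quots Num.conj r.2 f (move r.1 z)).
  rewrite -sumrB scaler_sumr; apply: eq_bigr => r _.
  by rewrite /quot moveC.
set S1 := \sum_(_ <- _ | _) _; set S2 := \sum_(_ <- _ | _) _.
rewrite /quot; set a := quots _ s f (move p z); set b := quots _ s f z.
have -> : (move p z 0 j)^* = (z 0 j)^* + (p.1 == j)%:R * (p.2)^*.
  rewrite !mxE eqxx /= eq_sym rmorphD rmorphM /= rmorph_nat addrC.
  by rewrite [(_ == _)%:R * _]mulrC.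
have pc : (p.2)^* != 0 by rewrite conjC_eq0.
have -> : ((z 0 j)^* + (p.1 == j)%:R * (p.2)^*) *: a + S1 - ((z 0 j)^* *: b + S2)
    = (z 0 j)^* *: (a - b) + (((p.1 == j)%:R * (p.2)^*) *: a + (S1 - S2)).
  by rewrite scalerBr scalerDl opprD -!addrA; congr (_ + _); rewrite addrCA addrCA [in RHS]addrCA; congr (_ + _); rewrite addrCA.
rewrite !scalerDr !scalerN !scalerA [(p.2)^*^-1 * (z 0 j)^*]mulrC.
rewrite [(p.2)^*^-1 * (_ * _)]mulrCA mulVf // mulr1.
by case: (p.1 == j); rewrite ?scale1r ?scale0r ?add0r -!scalerA -?scalerN.
Qed.

End Differences.

(** * The isometry along difference quotients *)

Section Kernel.
Variables (C : numClosedFieldType) (d : nat) (V : lmodType C).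
Variables (D : V -> Prop) (B : V -> V -> C).
Hypothesis hB : semi_inner D B.
Variables (gamma : 'rV[C]_d -> V) (phi : 'rV[C]_d -> C) (G : 'rV[C]_d -> Prop).
Hypothesis G_ball : forall w, G w -> sqnorm w < 1.
Hypothesis G_in : forall w, G w -> D (gamma w).
Hypothesis phi_le1 : forall w, G w -> `|phi w| <= 1.
Hypothesis kernelE : forall w w', G w -> G w' ->
  1 + \sum_j B ((w 0 j)^* *: gamma w) ((w' 0 j)^* *: gamma w') =
  (phi w)^* * phi w' + B (gamma w) (gamma w').
Local Notation step := ('I_d * C)%type.
Local Notation cquots := (quots Num.conj).
Implicit Types (s : seq step) (z w : 'rV[C]_d).

Let hf : hermitian_form B. Proof. by case: hB. Qed.

(* The graph of the isometry, with the form measuring its defect. *)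
Let W : lmodType C := (C^o * {ffun 'I_d -> V} * C^o * V)%type.

Let omega (w : 'rV[C]_d) : W :=
  (1, [ffun j => (w 0 j)^* *: gamma w], (phi w)^*, gamma w).

Let Om (x y : W) : C :=
  x.1.1.1 * (y.1.1.1)^* + row_form B x.1.1.2 y.1.1.2
  - (x.1.2 * (y.1.2)^* + B x.2 y.2).

Let Om_herm : hermitian_form Om.
Proof.
have hr := @row_form_hermitian C V D B d hB.
split=> [a [[[x1 x2] x3] x4] [[[y1 y2] y3] y4] [[[z1 z2] z3] z4]|x y]; rewrite /Om /=.
  rewrite (hformPl hr) (hformPl hf) /GRing.scale /=; ring.
rewrite rmorphB !rmorphD !rmorphM /= !conjCK -(hformC hr) -(hformC hf).
by rewrite ![_^* * _]mulrC.
Qed.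

Lemma quots_in s z : reach G s z -> D (cquots s gamma z).
Proof.
apply: quots_closed => // a x y Dx Dy.
by apply: (semi_innerZ hB); exact: (semi_innerB hB).
Qed.

Let isotropic w w' : G w -> G w' -> Om (omega w) (omega w') = 0.
Proof.
move=> Gw Gw'; rewrite /Om /= rmorph1 mulr1 conjCK -kernelE // /row_form.
by apply/eqP; rewrite subr_eq0; apply/eqP; congr (_ + _); apply: eq_bigr => j _; rewrite !ffunE.
Qed.

(** Iterated quotients are linear combinations of vectors [omega w] with [G w], and the form
    vanishes on pairs of these. *)
Let isotropic_quots s s' z z' : reach G s z -> reach G s' z' ->
  Om (cquots s omega z) (cquots s' omega z') = 0.
Proof.
move=> Gs Gs'.
apply: (@quots_closed _ _ _ _ _ G (fun x => Om x _ = 0)) Gs => [a x y x0 y0|w Gw].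
  by rewrite (hformZl Om_herm) (hformBl Om_herm) x0 y0 subrr mulr0.
apply: (@quots_closed _ _ _ _ _ G (fun x => Om _ x = 0)) Gs' => [a x y x0 y0|w' Gw'].
  by rewrite (hformZr Om_herm) (hformBr Om_herm) x0 y0 subrr mulr0.
exact: isotropic.
Qed.

(** Entry [j] gathers the Leibniz terms in which the coordinate [z_j^*] is differentiated. *)
Definition remainder s z : {ffun 'I_d -> V} :=
  \sum_(r <- picks s) single r.1.1 (cquots r.2 gamma (move r.1 z)).

(** The quotient of [omega] minus [a] times [omega z] is isotropic; computing its four components
    turns this into the identity. *)
Lemma quots_colligation s z (a : C) : nonzero_steps s -> s != [::] ->
  reach G s z ->
  `|(quots id s (phi : 'rV[C]_d -> C^o) z)^* - a * (phi z)^*| ^+ 2 +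
    B (cquots s gamma z - a *: gamma z) (cquots s gamma z - a *: gamma z) =
  `|a| ^+ 2 + \sum_j
    B ((z 0 j)^* *: (cquots s gamma z - a *: gamma z) + remainder s z j)
      ((z 0 j)^* *: (cquots s gamma z - a *: gamma z) + remainder s z j).
Proof.
move=> s_neq0 s_nil Gs; have Gz := reach_base Gs.
have Gz' : reach G [::] z by [].
pose x := cquots s omega z - a *: omega z.
have : Om x x = 0.
  rewrite /x (hformBl Om_herm) !(hformBr Om_herm) !(hformZl Om_herm) !(hformZr Om_herm).
  have H1 := isotropic_quots Gs Gs; have H2 := isotropic_quots Gs Gz'.
  have H3 := isotropic_quots Gz' Gs; have H4 := isotropic Gz Gz.
  by rewrite /= in H2 H3; rewrite H1 H2 H3 H4; ring.
(* The first component of [omega] is constant, so its quotient along the nonempty [s] vanishes. *)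
have x1 : x.1.1.1 = - a.
  rewrite /x /= (@quots_comp _ _ Num.conj _ omega Num.conj C^o (fun x : W => x.1.1.1)) //.
  rewrite (eq_quots _ (g := fun=> (1 : C^o))) // quots_cst; case: (s) s_nil => // *.
  by rewrite add0r /GRing.scale /= mulr1.
have x3 : x.1.2 = (quots id s (phi : 'rV[C]_d -> C^o) z)^* - a * (phi z)^*.
  rewrite /x /= (@quots_comp _ _ Num.conj _ omega Num.conj C^o (fun x : W => x.1.2)) //.
  rewrite (@quots_comp _ _ id C^o phi Num.conj C^o Num.conj) //.
  by move=> b u v; rewrite /GRing.scale /= rmorphM fmorphV rmorphB.
have x4 : x.2 = cquots s gamma z - a *: gamma z.
  by rewrite /x /= (@quots_comp _ _ Num.conj _ omega Num.conj V (fun x : W => x.2)).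
have x2 j : x.1.1.2 j = (z 0 j)^* *: (cquots s gamma z - a *: gamma z) + remainder s z j.
  rewrite /x /= !ffunE.
  rewrite (@quots_comp _ _ Num.conj _ omega Num.conj V (fun x : W => x.1.1.2 j)); last first.
    by move=> b u v; rewrite /= !ffunE.
  rewrite (eq_quots _ (g := fun w => (w 0 j)^* *: gamma w)); last by move=> w; rewrite /= ffunE.
  rewrite quots_coord // scalerBr addrAC [a *: (_ *: _)]scalerA mulrC -scalerA.
  congr (_ - _ + _); rewrite /remainder sum_ffunE big_mkcond /=.
  by apply: eq_bigr => r _; rewrite ffunE eq_sym.
rewrite /Om x1 x3 x4 -!normCK normrN => /eqP; rewrite subr_eq0 => /eqP <-.
by congr (_ + _); apply: eq_bigr => j _; rewrite x2.
Qed.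

Lemma remainder_terms_in s z r : reach G s z -> r \in picks s ->
  D (cquots r.2 gamma (move r.1 z)).
Proof. by move=> Gs rs; apply: quots_in; exact: reach_picks Gs. Qed.

Lemma remainder_in s z : reach G s z -> tuple_set D (remainder s z).
Proof.
move=> Gs j; rewrite /remainder sum_ffunE big_seq; apply: (big_ind D) => [|x y|r rs].
- exact: (semi_inner0 hB (G_in (reach_base Gs))).
- exact: (semi_innerD hB).
- by apply: (single_in hB); exact: remainder_terms_in Gs rs.
Qed.

(** [B'] stands for [row_form] in the norm bound and for [defect_form] in the coefficient bound. *)
Lemma seminorm_remainder (B' : {ffun 'I_d -> V} -> {ffun 'I_d -> V} -> C) s z :
  semi_inner (@tuple_set C V D d) B' -> reach G s z ->
  seminorm B' (remainder s z) <=
  \sum_(r <- picks s) seminorm B' (single r.1.1 (cquots r.2 gamma (move r.1 z))).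
Proof.
move=> hB' Gs; rewrite /remainder big_seq [leRHS]big_seq.
apply: (proj2 (seminorm_sum hB' _ (remainder_in Gs) _)) => r rs.
by apply: (single_in hB); exact: remainder_terms_in Gs rs.
Qed.

Lemma quots_norm_step s z : nonzero_steps s -> s != [::] -> reach G s z ->
  (1 - sqrtC (sqnorm z)) * seminorm B (cquots s gamma z) <=
  \sum_(r <- picks s) seminorm B (cquots r.2 gamma (move r.1 z)).
Proof.
move=> s_neq0 s_nil Gs.
have col a := quots_colligation a s_neq0 s_nil Gs.
apply: le_trans (row_norm_bound hB (quots_in Gs) (remainder_in Gs) col) _.
apply: le_trans (seminorm_remainder (row_form_semi _ hB) Gs) _.
rewrite le_eqVlt; apply/orP; left; apply/eqP; apply: eq_bigr => r _.
by rewrite /seminorm (row_form_single hB).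
Qed.

Lemma quots_coefficient s z : nonzero_steps s -> s != [::] -> reach G s z ->
  `|quots id s (phi : 'rV[C]_d -> C^o) z| <=
  sqrtC (1 - `|phi z| ^+ 2) * \sum_(r <- picks s)
    seminorm B (cquots r.2 gamma (move r.1 z)) *
    sqrtC (1 + `|z 0 r.1.1| ^+ 2 / (1 - sqnorm z)).
Proof.
move=> s_neq0 s_nil Gs; have Gz := reach_base Gs.
have z_lt1 := G_ball Gz.
have hD := defect_form_semi hB (G_in Gz) z_lt1.
have col a := quots_colligation a s_neq0 s_nil Gs.
have p_le1 : `|(phi z)^*| <= 1 by rewrite norm_conjC phi_le1.
have phi1 : 0 <= 1 - `|phi z| ^+ 2 by rewrite subr_ge0 expr_le1 // phi_le1.
have := coefficient_bound hB z_lt1 (G_in Gz) (quots_in Gs) (remainder_in Gs) col p_le1.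
rewrite !norm_conjC => H.
apply: (@le_trans _ _ (sqrtC (1 - `|phi z| ^+ 2) *
   seminorm (defect_form B z) (remainder s z))).
  rewrite -(@ler_pXn2r _ 2) ?nnegrE //; last first.
    apply: mulr_ge0; first by rewrite sqrtC_ge0.
    by apply: (seminorm_ge0 hD); exact: remainder_in.
  by rewrite exprMn seminorm_sqr !sqrtCK.
rewrite ler_wpM2l ?sqrtC_ge0 //.
apply: le_trans (seminorm_remainder hD Gs) _.
rewrite !big_seq le_eqVlt; apply/orP; left; apply/eqP; apply: eq_bigr => r rs.
rewrite /seminorm (defect_form_single hB) sqrtCM // qualifE /=.
  by rewrite (semi_inner_ge0 hB) //; exact: remainder_terms_in Gs rs.
by rewrite addr_ge0 ?divr_ge0 ?exprn_ge0 // subr_ge0 ltW.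
Qed.

Section Uniform.
Variables (N t : C).
Hypothesis t_lt1 : t < 1.
Hypothesis G_norm : forall w, G w -> sqrtC (sqnorm w) <= t.
Hypothesis G_gamma : forall w, G w -> seminorm B (gamma w) <= N.

(** Induction on the length: removing one step can be done in [size s] ways, which builds the
    factorial, and each round divides by [1 - |z| >= 1 - t]. *)
Lemma quots_norm_bound s z : nonzero_steps s -> reach G s z ->
  seminorm B (cquots s gamma z) <= (size s)`!%:R * (N / (1 - t) ^+ size s).
Proof.
have [n] := ubnP (size s); elim: n s z => // n IH s z /ltnSE s_le s_neq0 Gs.
case: (eqVneq s [::]) => [s0|s_nil].
  by rewrite s0 /= fact0 expr0 divr1 mul1r G_gamma //; exact: reach_base Gs.
have Gz := reach_base Gs.
have t_gt0 : 0 < 1 - t by rewrite subr_gt0.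
have s_gt0 : (0 < size s)%N by rewrite lt0n size_eq0.
rewrite -(ler_pM2l t_gt0).
apply: (@le_trans _ _ ((1 - sqrtC (sqnorm z)) * seminorm B (cquots s gamma z))).
  rewrite ler_wpM2r ?(seminorm_ge0 hB) ?lerD2l ?lerN2 ?G_norm //.
  exact: quots_in.
apply: le_trans (quots_norm_step s_neq0 s_nil Gs) _.
apply: (@le_trans _ _ (\sum_(r <- picks s) (size s).-1`!%:R * (N / (1 - t) ^+ (size s).-1))).
  rewrite big_seq [leRHS]big_seq; apply: ler_sum => r rs.
  have rp := picks_perm rs; have rsz := perm_size rp.
  rewrite /= in rsz; rewrite -rsz /=; apply: IH.
  - by rewrite -rsz in s_le.
  - by move: s_neq0; rewrite /nonzero_steps -(perm_all _ rp) /= => /andP[].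
  - exact: reach_picks Gs.
rewrite big_const_seq count_predT iter_addr_0.
have -> : size (picks s) = size s by rewrite -[in RHS](map_picks s) size_map.
rewrite -[_ *+ _]mulr_natl -(prednK s_gt0) /= factS natrM exprS.
rewrite le_eqVlt; apply/orP; left; apply/eqP.
by field; rewrite expf_neq0 ?gt_eqF.
Qed.

(** The coefficient estimate involves only lists with one step removed, hence the factorial and the
    power of order [(size s).-1]. *)
Lemma quots_bound s z : nonzero_steps s -> s != [::] -> reach G s z ->
  `|quots id s (phi : 'rV[C]_d -> C^o) z| <=
  sqrtC (1 - `|phi z| ^+ 2) * ((size s).-1`!%:R * (N / (1 - t) ^+ (size s).-1) *
  \sum_(p <- s) sqrtC (1 + `|z 0 p.1| ^+ 2 / (1 - sqnorm z))).
Proof.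
move=> s_neq0 s_nil Gs; have Gz := reach_base Gs.
have phi1 : 0 <= 1 - `|phi z| ^+ 2 by rewrite subr_ge0 expr_le1 // phi_le1.
apply: le_trans (quots_coefficient s_neq0 s_nil Gs) _.
rewrite ler_wpM2l ?sqrtC_ge0 //.
have -> : \sum_(p <- s) sqrtC (1 + `|z 0 p.1| ^+ 2 / (1 - sqnorm z)) =
    \sum_(r <- picks s) sqrtC (1 + `|z 0 r.1.1| ^+ 2 / (1 - sqnorm z)).
  by rewrite -[in LHS](map_picks s) big_map.
rewrite mulr_sumr big_seq [leRHS]big_seq.
apply: ler_sum => r rs.
apply: ler_wpM2r.
  by rewrite sqrtC_ge0 addr_ge0 ?divr_ge0 ?exprn_ge0 // subr_ge0 ltW // G_ball.
have rp := picks_perm rs; have rsz := perm_size rp.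
rewrite /= in rsz; rewrite -rsz /=; apply: quots_norm_bound.
  by move: s_neq0; rewrite /nonzero_steps -(perm_all _ rp) /= => /andP[].
exact: reach_picks Gs.
Qed.

End Uniform.
End Kernel.

(** * Limits of difference quotients *)

Section ComplexNumbers.
Variable R : realType.
Local Notation C := (Cplx R).

Lemma pos_complex (e : C) : 0 < e -> 0 < complex.Re e /\ ((complex.Re e)%:C)%C = e.
Proof.
move=> e0; have E : ((complex.Re e)%:C)%C = e by apply: RRe_real; exact: gtr0_real.
by split=> //; move: e0; rewrite -{1}E ltcR.
Qed.

(** Both numbers are real, being comparable with [0], so this is the Archimedean property of [R];
    powers of two match the halving of steps below. *)
Lemma complex_archimedean (x e : C) : 0 <= x -> 0 < e ->
  exists k : nat, x / 2 ^+ k < e.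
Proof.
move=> x0 /pos_complex[e0 eE].
have xE : ((complex.Re x)%:C)%C = x by apply: RRe_real; exact: ger0_real.
have := @upper_nthrootP R (complex.Re x / complex.Re e) _ (leqnn _).
set k := Num.bound _ => h; exists k.
have p0 : 0 < 2 ^+ k :> C by rewrite exprn_gt0.
rewrite ltr_pdivrMr //.
have -> : (2 ^+ k : C) = ((2 ^+ k : R)%:C)%C by rewrite rmorphXn rmorph_nat.
by rewrite -xE -eE -rmorphM ltcR mulrC -ltr_pdivrMr.
Qed.

Lemma normc_ge_Im (x : C) : (`|complex.Im x|%:C)%C <= `|x|.
Proof.
have := normc_ge_Re (x * 'i%C).
by rewrite ReiNIm normrN normrM normCi mulr1.
Qed.

(** Real and imaginary parts do not increase distances, so both image filters are Cauchy in [R]. *)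
Lemma complex_complete (F : set_system C) : ProperFilter F ->
  cauchy F -> cvg F.
Proof.
move=> FF /cauchyP cF.
have part (P : C -> R) : (forall x y, (`|P x - P y|%:C)%C <= `|x - y|) ->
    cvg (P x @[x --> F]).
  move=> Ple; apply: cauchy_cvg; apply: cauchy_exP => e e0.
  have [|x Fx] := cF ((e%:C)%C : C); first by rewrite ltcR.
  exists (P x); change (F (P @^-1` ball (P x) e)).
  apply: (@filterS _ F _ (ball x ((e%:C)%C : C))) Fx => y.
  rewrite /ball /= => xy; rewrite -ltcR; exact: le_lt_trans xy.
have reC : cvg (complex.Re x @[x --> F]).
  by apply: part => x y; rewrite -raddfB; exact: normc_ge_Re.
have imC : cvg (complex.Im x @[x --> F]).
  by apply: part => x y; rewrite -raddfB; exact: normc_ge_Im.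
set a := lim (complex.Re x @[x --> F]) in reC.
set b := lim (complex.Im x @[x --> F]) in imC.
apply/cvg_ex; exists ((a +i* b)%C : C).
apply/cvgrPdist_lt => e /pos_complex[e0 eE].
have e2 : 0 < complex.Re e / 2 by rewrite divr_gt0.
move/cvgrPdist_lt: reC => /(_ _ e2) reC.
move/cvgrPdist_lt: imC => /(_ _ e2) imC.
apply: filterS2 reC imC => x xa xb.
have -> : ((a +i* b)%C : C) - x =
    ((a - complex.Re x)%:C)%C + 'i%C * ((b - complex.Im x)%:C)%C.
  by rewrite [LHS]complexE; case: x {xa xb}.
apply: le_lt_trans (ler_normD _ _) _.
rewrite normrM normCi mul1r -eE (splitr (complex.Re e)).
have -> : ((complex.Re e / 2 + complex.Re e / 2)%:C)%C =
    ((complex.Re e / 2)%:C)%C + ((complex.Re e / 2)%:C)%C :> C by rewrite -rmorphD.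
by rewrite ltrD // normc_def /= expr0n addr0 sqrtr_sqr ltcR.
Qed.

End ComplexNumbers.

(** * Functions with locally bounded difference quotients *)

Section Tame.
Variables (C : numClosedFieldType) (d : nat).
Hypothesis archimedean : forall x e : C, 0 <= x -> 0 < e ->
  exists k : nat, x / 2 ^+ k < e.
Hypothesis complete : forall F : set_system C, ProperFilter F -> cauchy F -> cvg F.
Local Notation X := 'rV[C]_d.
Local Notation step := ('I_d * C)%type.
Implicit Types (s : seq step) (z w : X) (f : X -> C).

Definition dquots s f : X -> C := quots id s (f : X -> C^o).

Definition steps_norm s : C := \sum_(p <- s) `|p.2|.

Lemma norm_delta_le1 j : `|delta_mx 0 j : X| <= 1.
Proof.
have [->|/mx_norm_neq0[[i k] e]] := eqVneq `|delta_mx 0 j : X| 0; first exact: ler01.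
by rewrite [leLHS]e /= mxE; case: (_ && _); rewrite ?normr1 ?normr0 ?ler01.
Qed.

Lemma move_dist p z z0 : `|move p z - z0| <= `|p.2| + `|z - z0|.
Proof.
rewrite /move -addrA; apply: le_trans (ler_normD _ _) _.
by rewrite lerD2r normrZ ler_piMr // norm_delta_le1.
Qed.

Lemma reach_near (P : X -> Prop) z0 e s z : (forall w, `|w - z0| < e -> P w) ->
  `|z - z0| + steps_norm s < e -> reach P s z.
Proof.
move=> Pe; elim: s z => [|p s IH] z /=; rewrite /steps_norm.
  by rewrite big_nil addr0; exact: Pe.
rewrite big_cons => h; split; apply: IH; apply: le_lt_trans h.
  by rewrite lerD2l lerDr.
by rewrite addrA lerD2r addrC move_dist.
Qed.

(** Quotients commute, so the one along [h] may be taken innermost, where it converges at each of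
    the finitely many points visited. *)
Lemma dquots_cvg j s f z :
  reach (fun w => derivable f w (delta_mx 0 j)) s z ->
  dquots ((j, h) :: s) f z @[h --> 0^'] --> dquots s ('D_(delta_mx 0 j) f) z.
Proof.
elim: s z => [|p s IH] z /=; first by [].
case=> /IH h1 /IH h2.
have -> : (fun h => dquots [:: (j, h), p & s] f z) =
    (fun h => p.2^-1 * (dquots ((j, h) :: s) f (move p z) - dquots ((j, h) :: s) f z)).
  apply/funext => h; exact: quotC.
by apply: cvgM; [exact: cvg_cst|exact: cvgB].
Qed.

(* Halving [b] repeatedly sums a geometric series. *)
Lemma dyadic_bound (Q : C -> C) (L M : C) (b e : C) :
  Q h @[h --> 0^'] --> L -> 0 <= M -> b != 0 -> `|b| < e ->
  (forall h, h != 0 -> `|h + h| < e -> `|Q (h + h) - Q h| <= M * `|h|) ->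
  `|Q b - L| <= M * `|b|.
Proof.
move=> QL M0 b0 be Qd.
have step k : `|Q b - Q (b / 2 ^+ k)| <= M * `|b| * (1 - 2 ^- k).
  elim: k => [|k IH]; first by rewrite expr0 divr1 subrr normr0 invr1 subrr mulr0.
  pose h := b / 2 ^+ k.+1.
  have h2 : h + h = b / 2 ^+ k.
    by rewrite /h exprS; field; rewrite expf_neq0 ?pnatr_eq0.
  have h0 : h != 0 by rewrite mulf_neq0 ?invr_eq0 ?expf_neq0 ?pnatr_eq0.
  have hn : `|h| = `|b| * 2 ^- k.+1.
    by rewrite normrM normfV normrX (ger0_norm (ler0n _ 2)).
  have hle : `|h + h| < e.
    rewrite h2; apply: le_lt_trans be.
    by rewrite normrM normfV normrX (ger0_norm (ler0n _ 2)) ler_piMr // invf_le1 ?exprn_gt0 // exprn_ege1 // ler1n.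
  have := Qd h h0 hle; rewrite h2 hn => {}Qd.
  have -> : Q b - Q (b / 2 ^+ k.+1) = (Q b - Q (b / 2 ^+ k)) + (Q (b / 2 ^+ k) - Q h) by rewrite /h; ring.
  apply: le_trans (ler_normD _ _) _; apply: le_trans (lerD IH Qd) _.
  rewrite le_eqVlt; apply/orP; left; apply/eqP.
  by rewrite exprS; field; rewrite expf_neq0 ?pnatr_eq0.
apply/ler_addgt0Pr => ep ep0.
move/cvgrPdist_lt: QL => /(_ _ ep0) /nbhs_normP [r r0 Qr].
have [k kr] := archimedean (normr_ge0 b) r0.
have := Qr (b / 2 ^+ k); rewrite /= sub0r normrN.
have hn : `|b / 2 ^+ k| = `|b| / 2 ^+ k.
  by rewrite normrM normfV normrX (ger0_norm (ler0n _ 2)).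
rewrite hn => /(_ kr); rewrite mulf_neq0 ?invr_eq0 ?expf_neq0 ?pnatr_eq0 //.
move=> /(_ isT) LQ.
have -> : Q b - L = (Q b - Q (b / 2 ^+ k)) - (L - Q (b / 2 ^+ k)) by ring.
apply: le_trans (ler_normB _ _) _; apply: lerD; last exact: ltW.
by apply: le_trans (step k) _; rewrite ler_piMr ?mulr_ge0 // gerBl.
Qed.

(** Half the harmonic mean lies below both numbers; this avoids a minimum in the partial order of
    [C]. *)
Lemma common_radius (e1 e2 : C) : 0 < e1 -> 0 < e2 ->
  exists2 e, 0 < e & e <= e1 /\ e <= e2.
Proof.
move=> h1 h2; have h12 : 0 < e1 + e2 by rewrite addr_gt0.
exists (e1 * e2 / (e1 + e2)); first by rewrite divr_gt0 ?mulr_gt0.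
split; rewrite ler_pdivrMr // mulrDr.
  by rewrite lerDr mulr_ge0 ?ltW.
by rewrite mulrC lerDl mulr_ge0 ?ltW.
Qed.

Lemma lim_norm_le (T : Type) (F : set_system T) (u : T -> C) (l M : C) :
  ProperFilter F -> u x @[x --> F] --> l -> (\forall x \near F, `|u x| <= M) ->
  `|l| <= M.
Proof.
move=> FF ul uM; apply/ler_addgt0Pr => e e0.
move/cvgrPdist_lt: ul => /(_ _ e0) ul.
have [x [xl xM]] := filter_ex (filterI ul uM).
by rewrite -(subrK (u x) l) addrC; apply: le_trans (ler_normD _ _) _; rewrite lerD // ltW.
Qed.

Lemma near_dnbhs0_lt (e : C) : 0 < e -> \forall h \near (0 : C)^', h != 0 /\ `|h| < e.
Proof.
move=> e0; apply/nbhs_normP; exists e => //= h.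
by rewrite /ball_ /= sub0r normrN.
Qed.

Definition bounded_quots (n : nat) f z0 : Prop :=
  exists2 e : C, 0 < e & exists2 M : C, 0 <= M & forall s z,
    size s = n -> nonzero_steps s -> `|z - z0| + steps_norm s < e ->
    `|dquots s f z| <= M.

Variable U : X -> Prop.
Hypothesis U_open : forall z0, U z0 ->
  exists2 e : C, 0 < e & forall w, `|w - z0| < e -> U w.

(** A class stable under partial derivatives: bounds of order [n + 1] pass to bounds of order [n]
    for the derivative, and those of order three make it derivable again. *)
Definition tame f : Prop := forall z0, U z0 ->
  (forall j, derivable f z0 (delta_mx 0 j)) /\ forall n, bounded_quots n f z0.

Lemma steps_norm_cons p s : steps_norm (p :: s) = `|p.2| + steps_norm s.
Proof. by rewrite /steps_norm big_cons. Qed.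

Lemma tame_reach f j s z z0 e : tame f -> (forall w, `|w - z0| < e -> U w) ->
  `|z - z0| + steps_norm s < e ->
  reach (fun w => derivable f w (delta_mx 0 j)) s z.
Proof.
move=> tf eU; apply: reach_near => w /eU Uw.
by have [+ _] := tf _ Uw; apply.
Qed.

(** Doubling a step [h] changes the quotient by [h / 2] times a quotient of order [n + 2], which is
    bounded, so [dyadic_bound] applies. *)
Lemma dquots_approx f j n z0 : tame f -> U z0 ->
  exists2 e : C, 0 < e & exists2 M : C, 0 <= M & forall s z b,
    size s = n -> nonzero_steps s -> b != 0 ->
    `|z - z0| + steps_norm s + `|b| < e ->
    `|dquots ((j, b) :: s) f z - dquots s ('D_(delta_mx 0 j) f) z| <= M * `|b|.
Proof.
move=> tf Uz0; have [_ /(_ n.+2) [e1 e1_gt0 [M M0 fM]]] := tf _ Uz0.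
have [e2 e2_gt0 e2U] := U_open Uz0.
have [e e_gt0 [ee1 ee2]] := common_radius e1_gt0 e2_gt0.
exists e => //; exists M => // s z b sn s0 b0 lte.
apply: (@dyadic_bound (fun h => dquots ((j, h) :: s) f z) _ _ _
    (e - (`|z - z0| + steps_norm s))) => //.
- apply: dquots_cvg; apply: (tame_reach _ tf e2U).
  apply: lt_le_trans ee2; apply: le_lt_trans lte.
  by rewrite lerDl.
- by rewrite ltrBrDl.
move=> h h0; rewrite ltrBrDl => hh.
have -> : dquots ((j, h + h) :: s) f z - dquots ((j, h) :: s) f z =
    h / 2 * dquots [:: (j, h), (j, h) & s] f z by exact: quot_double.
rewrite normrM mulrC; apply: ler_pM => //; last first.
  rewrite normrM normfV (ger0_norm (ler0n _ 2)) ler_piMr // invf_le1 ?ltr0n //.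
  by rewrite ler1n.
apply: fM; rewrite /= ?sn ?h0 //.
apply: lt_le_trans ee1; apply: le_lt_trans hh.
have -> : `|h + h| = `|h| + `|h|.
  by rewrite -mulr2n normrMn mulr2n.
rewrite !steps_norm_cons /= le_eqVlt; apply/orP; left; apply/eqP; ring.
Qed.

Lemma tame_partial f j : tame f -> tame ('D_(delta_mx 0 j) f).
Proof.
move=> tf z0 Uz0; split=> [k|n]; last first.
  have [_ /(_ n.+1) [e1 e1_gt0 [M M0 fM]]] := tf _ Uz0.
  have [e2 e2_gt0 e2U] := U_open Uz0.
  have [e e_gt0 [ee1 ee2]] := common_radius e1_gt0 e2_gt0.
  exists e => //; exists M => // s z sn s0 lte.
  have sz2 : `|z - z0| + steps_norm s < e2 by exact: lt_le_trans ee2.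
  apply: lim_norm_le (dquots_cvg (tame_reach j tf e2U sz2)) _.
  have r0 : 0 < e - (`|z - z0| + steps_norm s) by rewrite subr_gt0.
  apply: filterS (near_dnbhs0_lt r0) => h [h0 hr].
  apply: fM; rewrite /= ?sn ?h0 //.
  apply: lt_le_trans ee1; rewrite steps_norm_cons /= addrCA.
  by rewrite -ltrBrDr.
have [e1 e1_gt0 [M M0 fM]] := dquots_approx j 1 tf Uz0.
have [e2 e2_gt0 e2U] := U_open Uz0.
have [e e_gt0 [ee1 ee2]] := common_radius e1_gt0 e2_gt0.
(* A limit along step [b] is uniform in the step [a] of the other direction, so
   it may be exchanged with the limit [a -> 0]. *)
apply: (complete (F := dquots [:: (k, a)] ('D_(delta_mx 0 j) f) z0 @[a --> 0^'])).
apply: cauchy_exP => ep ep0.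
have ep2 : 0 < ep / 2 by rewrite divr_gt0.
have M1 : 0 < M + 1 by rewrite ltr_wpDl.
(* The step [b] must satisfy [|b| < e / 2] and [(M + 1) |b| < ep / 2]; using [M + 1] avoids dividing
   by a possibly zero [M]. *)
have [r r0 [r1 r2]] := common_radius (divr_gt0 e_gt0 (ltr0n _ 2)) (divr_gt0 ep2 M1).
have [b [b0 br]] := filter_ex (near_dnbhs0_lt r0).
exists (dquots [:: (j, b)] ('D_(delta_mx 0 k) f) z0).
have reach_b : `|z0 - z0| + steps_norm [:: (j, b)] < e2.
  rewrite subrr normr0 add0r /steps_norm big_seq1 /=.
  apply: lt_le_trans ee2; apply: lt_trans br _; apply: le_lt_trans r1 _.
  by rewrite ltr_pdivrMr // ltr_pMr // ltr1n.
have /cvgrPdist_lt /(_ _ ep2) near1 := dquots_cvg (tame_reach k tf e2U reach_b).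
have e_half : 0 < e / 2 by rewrite divr_gt0.
apply: filterS2 near1 (near_dnbhs0_lt e_half) => a La [a0 ae].
rewrite /ball /= (splitr ep).
have -> (x y : C) : x - y = (x - dquots [:: (k, a); (j, b)] f z0)
   + (dquots [:: (j, b); (k, a)] f z0 - y).
  have -> : dquots [:: (j, b); (k, a)] f z0 = dquots [:: (k, a); (j, b)] f z0.
    exact: quotC.
  by ring.
apply: le_lt_trans (ler_normD _ _) _; apply: ltrD => //.
apply: le_lt_trans (fM _ _ _ _ _ _ _) _; rewrite //= ?a0 //.
  rewrite subrr normr0 add0r /steps_norm big_seq1 /=.
  apply: lt_le_trans ee1; rewrite (splitr e) ltrD //.
  exact: lt_le_trans r1.
apply: (@le_lt_trans _ _ ((M + 1) * `|b|)); first by rewrite ler_wpM2r ?lerDl.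
by rewrite mulrC -ltr_pdivlMr //; exact: lt_le_trans r2.
Qed.

(** Letting the steps tend to zero one at a time turns quotients into derivatives, and the bound [K]
    survives each limit. *)
Lemma tame_iterated_bound js f z0 e (K : C) : tame f -> U z0 -> 0 < e ->
  (forall s, map fst s = js -> nonzero_steps s -> steps_norm s < e ->
    `|dquots s f z0| <= K) ->
  `|foldl (fun g j => 'D_(delta_mx 0 j) g) f js z0| <= K.
Proof.
move=> tf Uz0 e1_gt0; have [e2 e2_gt0 e2U] := U_open Uz0.
have [r r_gt0 [re r2]] := common_radius e1_gt0 e2_gt0.
move=> fK.
have {re fK} : forall s, map fst s = js -> nonzero_steps s -> steps_norm s < r ->
    `|dquots s f z0| <= K.
  by move=> s s1 s0 sr; apply: fK => //; exact: lt_le_trans re.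
elim: js f tf => [|j js IH] f tf fK /=.
  by apply: (fK [::]) => //; rewrite /steps_norm big_nil.
apply: IH; first exact: tame_partial.
move=> s s1 s0 sr.
have sz2 : `|z0 - z0| + steps_norm s < e2.
  by rewrite subrr normr0 add0r; exact: lt_le_trans r2.
apply: lim_norm_le (dquots_cvg (tame_reach j tf e2U sz2)) _.
have r0 : 0 < r - steps_norm s by rewrite subr_gt0.
apply: filterS (near_dnbhs0_lt r0) => h [h0 hr].
apply: fK; rewrite /= ?s1 ?h0 //.
by rewrite steps_norm_cons /= -ltrBrDr.
Qed.

End Tame.

(** * The Arveson space *)

Section Multiplier.
Variables (R : realType) (d : nat) (H : arveson_space R d).
Variable phi : 'rV[Cplx R]_d -> Cplx R.
Hypothesis phiM : contractive_multiplier H phi.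
Local Notation C := (Cplx R).
Local Notation dot := (@av_dot R d H).

Lemma unit_ballE (z : 'rV[C]_d) : unit_ball z = (sqnorm z < 1) :> Prop.
Proof. by []. Qed.

Lemma av_dot_hermitian : hermitian_form dot.
Proof.
split=> [a x y z|x y]; first exact: linearPl.
by rewrite hermC /= expr0 mul1r.
Qed.

Lemma av_dot_semi : semi_inner (fun=> True) dot.
Proof.
by split; [exact: av_dot_hermitian|move=> *|move=> x _; rewrite -av_normE exprn_ge0].
Qed.

(** Cauchy-Schwarz gives [|<z, w>|^2 <= |z|^2 |w|^2 < 1]. *)
Lemma inner_neq1 (z w : 'rV[C]_d) : unit_ball z -> unit_ball w ->
  1 - inner z w != 0.
Proof.
rewrite !unit_ballE => zB wB.
have hb : semi_inner (fun=> True) (fun x y : C^o => x * y^*).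
  split=> [|//|x _]; last by rewrite -normCK exprn_ge0.
  split=> [a x y t|x y]; first by rewrite mulrDl -mulrA.
  by rewrite rmorphM /= conjCK mulrC.
have := cauchy_schwarz (row_form_semi d hb) (x := [ffun j => z 0 j])
  (y := [ffun j => w 0 j]) (fun=> I) (fun=> I).
rewrite /row_form.
have rowE (x y : 'rV[C]_d) : \sum_j [ffun j => x 0 j] j * ([ffun j => y 0 j] j)^*
  = inner x y by apply: eq_bigr => j _; rewrite !ffunE.
have nrm (x : 'rV[C]_d) : inner x x = sqnorm x.
  by apply: eq_bigr => j _; rewrite normCK.
rewrite !rowE !nrm => h; apply/eqP => /eqP; rewrite subr_eq0 => /eqP e.
move: h; rewrite -e normr1 expr1n => h.
have := mulr_ilt1 (sqnorm_ge0 z) (sqnorm_ge0 w) zB wB.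
by move/(le_lt_trans h); rewrite ltxx.
Qed.

Let HH : lmodType C := (H * H)%type.

(* The graph of the adjoint of multiplication by [phi]. *)
Definition adjoint_graph (x : HH) : Prop :=
  forall u g : H, (forall z, unit_ball z -> av_eval g z = phi z * av_eval u z) ->
    dot u x.2 = dot g x.1.

Definition graph_form (x y : HH) : C := dot x.1 y.1 - dot x.2 y.2.

(** Nonnegativity says that the adjoint is contractive: if [x2] is the image of [x1] and
    [g = phi x2], then [|x2|^2 = <g, x1> <= |g| |x1| <= |x2| |x1|]. *)
Lemma graph_form_semi : semi_inner adjoint_graph graph_form.
Proof.
have hd := av_dot_hermitian.
split.
- split=> [a x y z|x y]; rewrite /graph_form /=.
    by rewrite !(hformPl hd); ring.
  by rewrite rmorphB /= -!(hformC hd).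
- move=> a x y Dx Dy u g ug /=.
  by rewrite !(hformDr hd) !(hformZr hd) (Dx _ _ ug) (Dy _ _ ug).
move=> [x1 x2] Dx; rewrite /graph_form /= subr_ge0.
have [g gE gle] := phiM x2; have := Dx x2 g gE => /= e.
have n2 : dot x2 x2 = `|x2| ^+ 2 by rewrite av_normE.
have n1 : dot x1 x1 = `|x1| ^+ 2 by rewrite av_normE.
have h : `|x2| ^+ 2 <= `|x2| * `|x1|.
  have <- : `|dot g x1| = `|x2| ^+ 2 by rewrite -e n2 ger0_norm ?exprn_ge0.
  have := le_seminorm_hform av_dot_semi (x:=g) (y:=x1) I I.
  rewrite /seminorm -!av_normE !sqrCK ?normr_ge0 // => /le_trans; apply.
  by rewrite ler_wpM2r.
rewrite n1 n2 ler_pXn2r ?nnegrE ?normr_ge0 //.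
have [->|x2_neq0] := eqVneq `|x2| 0; first exact: normr_ge0.
by move: h; rewrite expr2 ler_pM2l // lt_def x2_neq0 normr_ge0.
Qed.

(** The adjoint sends the reproducing vector [k_w] to [phi(w)^* k_w], so [gamma(w)] is the pair of
    the two. *)
Lemma kernel_exists : exists gamma : 'rV[C]_d -> HH,
  (forall w, unit_ball w -> adjoint_graph (gamma w)) /\
  forall w w', unit_ball w -> unit_ball w' ->
    (1 - inner w' w) * graph_form (gamma w) (gamma w') = 1 - (phi w)^* * phi w'.
Proof.
have hd := av_dot_hermitian.
have /choice [kap kapP] : forall w, exists k : H, unit_ball w ->
   (forall z, unit_ball z -> av_eval k z = (1 - inner z w)^-1) /\
   forall f, dot f k = av_eval f w.
  move=> w; have [wB|wNB] := pselect (unit_ball w); last by exists 0.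
  by have [k k1 k2] := av_reproducing H wB; exists k.
exists (fun w => (kap w, (phi w)^* *: kap w)); split=> [w wB u g ug|w w' wB w'B] /=.
  have [_ kw] := kapP w wB.
  by rewrite (hformZr hd) !kw ug // conjCK.
have [e1 _] := kapP w wB; have [_ e2] := kapP w' w'B.
rewrite /graph_form /= (hformZr hd) (hformZl hd) conjCK e2 e1 //.
have := inner_neq1 w'B wB.
by move=> h; field.
Qed.
End Multiplier.

(** * Passage to the limit *)

Section Local.
Variables (C : numClosedFieldType) (d : nat).
Local Notation X := 'rV[C]_d.
Implicit Types (z w : X).

Lemma near_lt_of_continuous (u : X -> C) z0 t : (forall w, u w \is Num.real) ->
  {for z0, continuous u} -> 0 < t -> \forall w \near z0, u w < u z0 + t.
Proof.
move=> ur uc t0; move/cvgrPdist_lt: uc => /(_ _ t0); apply: filterS => w.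
rewrite distrC => h; rewrite -ltrBlDl; apply: le_lt_trans h.
by apply: real_ler_norm; rewrite rpredB.
Qed.

Lemma sqnorm_continuous : continuous (@sqnorm C d : X -> C).
Proof.
apply: continuous_big => [|j _ z]; first exact: add_continuous.
have cn : `|w 0 j| @[w --> z] --> `|z 0 j| by apply: cvg_norm; exact: coord_continuous.
exact: (cvgM cn cn).
Qed.

Lemma sqnorm_real z : sqnorm z \is Num.real.
Proof. by rewrite ger0_real // sqnorm_ge0. Qed.

Lemma sqnorm_lt1_open z0 : sqnorm z0 < 1 -> \forall w \near z0, sqnorm w < 1.
Proof.
move=> z1; have := near_lt_of_continuous sqnorm_real (@sqnorm_continuous z0) (t := 1 - sqnorm z0).
by rewrite subr_gt0 addrC subrK; apply.
Qed.

Lemma sqrtC_le_add (a x t : C) : 0 <= a -> 0 <= x -> 0 <= t ->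
  x <= a + t ^+ 2 -> sqrtC x <= sqrtC a + t.
Proof.
move=> a0 x0 t0 h; rewrite -(@ler_pXn2r _ 2) ?nnegrE ?addr_ge0 ?sqrtC_ge0 //.
rewrite sqrtCK sqrrD sqrtCK; apply: le_trans h _.
by rewrite lerD2r lerDl mulrn_wge0 // mulr_ge0 // sqrtC_ge0.
Qed.

(** The kernel on the diagonal, that is, the squared norm of [gamma(z)]. *)
Definition defect_ratio (phi : X -> C) z : C := (1 - `|phi z| ^+ 2) / (1 - sqnorm z).

Lemma defect_ratio_real (phi : X -> C) z : defect_ratio phi z \is Num.real.
Proof.
by rewrite rpredM ?rpredV ?rpredB ?rpred1 ?sqnorm_real // rpredX // normr_real.
Qed.

Lemma cvg_defect (T : Type) (F : set_system T) (FF : Filter F) (f g : T -> C) a b :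
  f x @[x --> F] --> a -> g x @[x --> F] --> b -> 1 - b != 0 ->
  (1 - `|f x| ^+ 2) / (1 - g x) @[x --> F] --> (1 - `|a| ^+ 2) / (1 - b).
Proof.
move=> fa gb b1; have cn : `|f x| @[x --> F] --> `|a| by exact: cvg_norm.
apply: cvgM; last by apply: cvgV => //; apply: cvgB => //; exact: cvg_cst.
by apply: cvgB; [exact: cvg_cst|exact: (cvgM cn cn)].
Qed.

Lemma defect_ratio_continuous (phi : X -> C) z0 : {for z0, continuous phi} ->
  sqnorm z0 < 1 -> {for z0, continuous (defect_ratio phi)}.
Proof.
move=> pc z1; apply: (cvg_defect (nbhs_filter z0) pc (@sqnorm_continuous z0)).
by rewrite gt_eqF // subr_gt0.
Qed.

(** The slack [t ^+ 2] on a square becomes at most [t] after taking roots. *)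
Lemma local_radius (phi : X -> C) z0 t : {for z0, continuous phi} -> sqnorm z0 < 1 -> 0 < t ->
  exists2 e : C, 0 < e & forall w, `|w - z0| < e ->
    [/\ sqnorm w < 1, sqrtC (sqnorm w) <= sqrtC (sqnorm z0) + t &
      defect_ratio phi w <= defect_ratio phi z0 + t ^+ 2].
Proof.
move=> pc z1 t0; have t2 : 0 < t ^+ 2 by rewrite exprn_gt0.
have n1 := sqnorm_lt1_open z1.
have n2 := near_lt_of_continuous sqnorm_real (@sqnorm_continuous z0) t2.
have n3 := near_lt_of_continuous (defect_ratio_real phi) (defect_ratio_continuous pc z1) t2.
have : \forall w \near z0, [/\ sqnorm w < 1, sqnorm w < sqnorm z0 + t ^+ 2 &
    defect_ratio phi w < defect_ratio phi z0 + t ^+ 2].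
  by near do split.
move=> /nbhs_normP [e e0 eP].
exists e => // w we; have [|w1 w2 w3] := eP w; first by rewrite /ball_ /= distrC.
by split=> //; [apply: sqrtC_le_add; rewrite ?sqnorm_ge0 ?(ltW t0) ?(ltW w2)|exact: ltW].
Unshelve. all: by end_near.
Qed.

Lemma sqrtC_lt1 (x : C) : 0 <= x -> x < 1 -> sqrtC x < 1.
Proof.
by move=> x0 x1; rewrite -(@ltr_pXn2r _ 2) ?nnegrE ?sqrtC_ge0 // sqrtCK expr1n.
Qed.

Lemma sqnorm_coord z j : `|z 0 j| ^+ 2 <= sqnorm z.
Proof.
by rewrite /sqnorm (bigD1 j) //= lerDl sumr_ge0.
Qed.

Lemma weight_bound z j (r : C) : sqrtC (sqnorm z) <= r -> r < 1 ->
  sqrtC (1 + `|z 0 j| ^+ 2 / (1 - sqnorm z)) <= sqrtC (1 + 1 / (1 - r ^+ 2)).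
Proof.
move=> zr r1; have r0 : 0 <= r by apply: le_trans zr; rewrite sqrtC_ge0 sqnorm_ge0.
have r2 : 0 < 1 - r ^+ 2 by rewrite subr_gt0 expr_lt1.
have zr2 : sqnorm z <= r ^+ 2.
  by rewrite -[leLHS]sqrtCK ler_pXn2r // nnegrE sqrtC_ge0 sqnorm_ge0.
have z1 : 0 < 1 - sqnorm z by apply: lt_le_trans r2 _; rewrite lerD2l lerN2.
rewrite ler_sqrtC ?qualifE /= ?addr_ge0 ?divr_ge0 ?exprn_ge0 ?(ltW z1) ?(ltW r2) //.
rewrite lerD2l ler_pM ?invr_ge0 ?exprn_ge0 ?(ltW z1) //.
  by apply: le_trans (sqnorm_coord z j) _; apply: ltW; rewrite -subr_gt0.
by rewrite lef_pV2 ?posrE // lerD2l lerN2.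
Qed.

(** The final estimate with slack [t] on [N], the norm of [gamma(z)], and on [a], the norm of
    [z]. *)
Definition limit_bound (S k N a T : C) (m : nat) (t : C) : C :=
  S * (k * ((N + t) / (1 - (a + t)) ^+ m) * T).

Lemma cvg_limit_bound (Y : Type) (F : set_system Y) (FF : Filter F) (f : Y -> C)
    (S k N a T b : C) m : f x @[x --> F] --> b -> a + b < 1 ->
  limit_bound S k N a T m (f x) @[x --> F] --> limit_bound S k N a T m b.
Proof.
move=> fb ab; rewrite /limit_bound.
have ct (c : C) : c + f x @[x --> F] --> c + b by apply: cvgD => //; exact: cvg_cst.
have c1 : 1 - (a + f x) @[x --> F] --> 1 - (a + b).
  by apply: cvgB; [exact: cvg_cst|exact: ct].
have cm : (1 - (a + f x)) ^+ m @[x --> F] --> (1 - (a + b)) ^+ m.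
  elim: (m) => [|i IH]; first exact: cvg_cst.
  by rewrite exprS; under eq_fun do rewrite exprS; exact: (cvgM c1 IH).
apply: cvgM; first exact: cvg_cst.
apply: cvgM; last exact: cvg_cst.
apply: cvgM; first exact: cvg_cst.
apply: cvgM; first exact: ct.
by apply: cvgV => //; rewrite expf_neq0 // gt_eqF // subr_gt0.
Qed.

Lemma limit_bound_continuous (S k N a T : C) m : a < 1 ->
  {for 0, continuous (limit_bound S k N a T m)}.
Proof.
move=> a1.
apply: (@cvg_limit_bound C (nbhs (0 : C)) (nbhs_filter (0 : C)) id S k N a T 0 m).
  exact: cvg_id.
by rewrite addr0.
Qed.

(** With [P = 1 - |phi(z)|^2] and [Q = 1 - |z|^2], the factors [sqrt P], [sqrt P / sqrt Q] and the
    [1 / sqrt Q] inside the weights multiply to [P / Q]. *)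
Lemma limit_bound0 (phi : X -> C) z (k : C) m (c : 'I_d -> C) :
  sqnorm z < 1 -> `|phi z| <= 1 ->
  limit_bound (sqrtC (1 - `|phi z| ^+ 2)) k (sqrtC (defect_ratio phi z))
    (sqrtC (sqnorm z)) (\sum_j c j * sqrtC (1 + `|z 0 j| ^+ 2 / (1 - sqnorm z))) m 0 =
  k * ((1 - `|phi z| ^+ 2) / ((1 - sqnorm z) * (1 - sqrtC (sqnorm z)) ^+ m)) *
  \sum_j c j * sqrtC (1 - (sqnorm z - `|z 0 j| ^+ 2)).
Proof.
move=> z1 p1; rewrite /limit_bound !addr0.
have q0 : 0 < 1 - sqnorm z by rewrite subr_gt0.
have P0 : 0 <= 1 - `|phi z| ^+ 2 by rewrite subr_ge0 expr_le1.
have a0 : 1 - sqrtC (sqnorm z) != 0 by rewrite gt_eqF // subr_gt0 sqrtC_lt1 ?sqnorm_ge0.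
set P := 1 - `|phi z| ^+ 2 in P0 *; set Q := 1 - sqnorm z in q0 *.
have sq0 : sqrtC Q != 0 by rewrite sqrtC_eq0 gt_eqF.
have -> : \sum_j c j * sqrtC (1 + `|z 0 j| ^+ 2 / Q) =
   (\sum_j c j * sqrtC (1 - (sqnorm z - `|z 0 j| ^+ 2))) / sqrtC Q.
  rewrite mulr_suml; apply: eq_bigr => j _; rewrite -mulrA; congr (_ * _).
  have -> : 1 + `|z 0 j| ^+ 2 / Q = (1 - (sqnorm z - `|z 0 j| ^+ 2)) / Q.
    by rewrite /Q; field; rewrite gt_eqF.
  by rewrite rootCMr ?invr_ge0 ?(ltW q0) // rootCV // ltW.
have -> : sqrtC (defect_ratio phi z) = sqrtC P / sqrtC Q.
  by rewrite /defect_ratio -/P -/Q rootCMr ?invr_ge0 ?(ltW q0) // rootCV // ltW.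
set T := \sum_j _; have e1 := sqrtCK P; have e2 := sqrtCK Q.
rewrite -[in RHS]e1 -[in RHS]e2.
by field; rewrite sq0 expf_neq0.
Qed.

Lemma sum_steps (s : seq ('I_d * C)) (F : 'I_d -> C) :
  \sum_(p <- s) F p.1 = \sum_(j <- map fst s) F j.
Proof. by rewrite big_map. Qed.

(** Directions in the order of differentiation, making a mixed partial a single fold with one
    derivative per letter. *)
Definition direction_word (nu : 'I_d -> nat) : seq 'I_d :=
  flatten [seq nseq (nu j) j | j <- enum 'I_d].

Lemma size_direction_word nu : size (direction_word nu) = (\sum_j nu j)%N.
Proof.
rewrite size_flatten /shape -map_comp sumnE big_map big_enum /=.
by apply: eq_bigr => j _; rewrite size_nseq.
Qed.

Lemma sum_direction_word nu (F : 'I_d -> C) :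
  \sum_(j <- direction_word nu) F j = \sum_j (nu j)%:R * F j.
Proof.
rewrite /direction_word big_flatten big_map big_enum /=; apply: eq_bigr => j _.
by rewrite big_nseq iter_addr_0 mulr_natl.
Qed.

Lemma foldl_direction_word (T : Type) (g : T -> 'I_d -> T) nu x :
  foldl g x (direction_word nu) = foldl (fun y j => iter (nu j) (g^~ j) y) x (enum 'I_d).
Proof.
rewrite /direction_word; elim: (enum _) x => [//|j js IH] x /=.
rewrite foldl_cat IH; congr foldl; elim: (nu j) x => [//|n IHn] x /=.
by rewrite IHn -iterSr.
Qed.

(** Used with [x = <w', w>], [p = phi(w)^* phi(w')] and [b] the form on [gamma(w)], [gamma(w')]. *)
Lemma defect_rearrange (x p b : C) : (1 - x) * b = 1 - p -> 1 + x * b = p + b.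
Proof.
move=> e; have -> : p = 1 - (1 - x) * b; last by ring.
by rewrite e; ring.
Qed.

(** Continuity controls only the modulus of [u t - u 0]; realness of both values turns this into an
    inequality. *)
Lemma le_of_right_limit (u : C -> C) (x e : C) : {for 0, continuous u} -> 0 < e ->
  u 0 \is Num.real ->
  (forall t, 0 < t -> t < e -> u t \is Num.real /\ x <= u t) -> x <= u 0.
Proof.
move=> uc e0 u0 xu; apply/ler_addgt0Pr => r r0.
move/cvgrPdist_lt: uc => /(_ _ r0) /nbhs_normP [b b0 bu].
have [c c0 [ce cb]] := common_radius e0 b0.
have c2 : 0 < c / 2 by rewrite divr_gt0.
have cc : c / 2 < c by rewrite ltr_pdivrMr // ltr_pMr // ltr1n.
have [ur xr] := xu _ c2 (lt_le_trans cc ce).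
apply: (le_trans xr); rewrite -lerBlDl.
have := bu (c / 2); rewrite /= sub0r normrN (gtr0_norm c2) => /(_ (lt_le_trans cc cb)).
rewrite distrC => h; apply: le_trans (ltW h).
by apply: real_ler_norm; rewrite rpredB.
Qed.

End Local.

(** * Quotient bounds near a point of the ball *)

Section Ball.
Variables (R : realType) (d : nat) (phi : 'rV[Cplx R]_d -> Cplx R).
Hypothesis phi_SA : schur_agler phi.
Local Notation C := (Cplx R).
Local Notation X := 'rV[C]_d.

Lemma unit_ball_open (z0 : X) : unit_ball z0 ->
  exists2 e : C, 0 < e & forall w, `|w - z0| < e -> unit_ball w.
Proof.
rewrite unit_ballE => /sqnorm_lt1_open /nbhs_normP [e e0 eB].
by exists e => // w we; apply: eB; rewrite /ball_ /= distrC.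
Qed.

Lemma innerE (z w : X) : inner z w = \sum_j (w 0 j)^* * z 0 j.
Proof. by apply: eq_bigr => j _; rewrite mulrC. Qed.

Lemma inner_sqnorm (z : X) : inner z z = sqnorm z.
Proof. by apply: eq_bigr => j _; rewrite normCK. Qed.

Lemma schur_agler_kernel : exists (V : lmodType C) (D : V -> Prop) (B : V -> V -> C)
    (gamma : X -> V), semi_inner D B /\ [/\
  forall w, unit_ball w -> D (gamma w),
  forall w w', unit_ball w -> unit_ball w' ->
    1 + \sum_j B ((w 0 j)^* *: gamma w) ((w' 0 j)^* *: gamma w') =
    (phi w)^* * phi w' + B (gamma w) (gamma w') &
  forall w, unit_ball w ->
    B (gamma w) (gamma w) = (1 - `|phi w| ^+ 2) / (1 - sqnorm w)].
Proof.
have [_ [H phiM]] := phi_SA.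
have [gamma [gD gE]] := kernel_exists H phi.
have hB := graph_form_semi phiM.
have hf : hermitian_form (@graph_form R d H) by case: hB.
exists _, (adjoint_graph phi), (@graph_form R d H), gamma; split=> //.
split=> // [w w' wB w'B|w wB].
  rewrite -(defect_rearrange (gE _ _ wB w'B)) innerE mulr_suml; congr (_ + _).
  by apply: eq_bigr => j _; rewrite (hformZl hf) (hformZr hf) conjCK mulrA.
have := gE _ _ wB wB; rewrite inner_sqnorm [_^* * _]mulrC -normCK => <-.
rewrite mulrC mulKf // gt_eqF // subr_gt0.
by move: wB; rewrite unit_ballE.
Qed.

(** The second group of facts also covers the empty list, from which [|phi z0| <= 1] is later read
    off. *)
Lemma schur_agler_near (z0 : X) (t : C) : unit_ball z0 -> 0 < t ->
  sqrtC (sqnorm z0) + t < 1 ->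
  exists2 e : C, 0 < e & forall s z, nonzero_steps s ->
    `|z - z0| + steps_norm s < e ->
    (s != [::] -> `|dquots s phi z| <= sqrtC (1 - `|phi z| ^+ 2) *
      ((size s).-1`!%:R * ((sqrtC (defect_ratio phi z0) + t) /
        (1 - (sqrtC (sqnorm z0) + t)) ^+ (size s).-1) *
      \sum_(p <- s) sqrtC (1 + `|z 0 p.1| ^+ 2 / (1 - sqnorm z)))) /\
    [/\ `|phi z| <= 1, sqnorm z < 1 & sqrtC (sqnorm z) <= sqrtC (sqnorm z0) + t].
Proof.
move=> z0B t0 t1; have z01 : sqnorm z0 < 1 by move: z0B; rewrite unit_ballE.
have [V [D [B [gamma [hB [gD gE gN]]]]]] := schur_agler_kernel.
have ratio_ge0 w : unit_ball w -> 0 <= defect_ratio phi w.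
  by move=> wB; rewrite /defect_ratio -gN // (semi_inner_ge0 hB) //; exact: gD.
have phi_le1 w : unit_ball w -> `|phi w| <= 1.
  move=> wB; rewrite -(@expr_le1 _ 2) // -subr_ge0.
  have := ratio_ge0 w wB; rewrite /defect_ratio pmulr_lge0 // invr_gt0 subr_gt0.
  by move: wB; rewrite unit_ballE.
have pc : {for z0, continuous phi}.
  by apply: differentiable_continuous; case: phi_SA => + _; apply.
have [e e0 eP] := local_radius pc z01 t0.
exists e => // s z s0 sz.
pose G w := [/\ sqnorm w < 1, sqrtC (sqnorm w) <= sqrtC (sqnorm z0) + t &
      defect_ratio phi w <= defect_ratio phi z0 + t ^+ 2].
have Gs : reach G s z by exact: reach_near eP sz.
have GB w : G w -> unit_ball w by rewrite unit_ballE; case.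
split; last first.
  by have [? ? ?] := reach_base Gs; split=> //; apply: phi_le1; apply: GB; exact: reach_base Gs.
move=> s_nil; apply: (quots_bound hB (gamma := gamma) (G := G)) => //.
- by move=> w /GB; exact: gD.
- by move=> w /GB; exact: phi_le1.
- by move=> w w' /GB ? /GB ?; exact: gE.
- by move=> w [].
move=> w Gw; have wB := GB w Gw; have [_ _ wd] := Gw.
rewrite /seminorm gN // -/(defect_ratio phi w).
by apply: sqrtC_le_add; rewrite ?ratio_ge0 // ltW.
Qed.

End Ball.

(** * Tameness of [phi] and the derivative bound *)

Section Final.
Variables (R : realType) (d : nat) (phi : 'rV[Cplx R]_d -> Cplx R).
Hypothesis phi_SA : schur_agler phi.
Local Notation C := (Cplx R).
Local Notation X := 'rV[C]_d.

Lemma schur_agler_tame : tame (@unit_ball R d) phi.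
Proof.
move=> z0 z0B; split=> [j|n].
  by apply: diff_derivable; case: phi_SA => + _; apply.
have z01 : sqnorm z0 < 1 by move: z0B; rewrite unit_ballE.
set a := sqrtC (sqnorm z0).
have a0 : 0 <= a by rewrite sqrtC_ge0 sqnorm_ge0.
have a1 : a < 1 by apply: sqrtC_lt1 => //; exact: sqnorm_ge0.
(* With this slack [a + t] is halfway between [a] and [1], so the denominators stay positive. *)
pose t := (1 - a) / 2.
have t0 : 0 < t by rewrite divr_gt0 // subr_gt0.
have at1 : a + t < 1.
  by rewrite -ltrBrDl ltr_pdivrMr // ltr_pMr ?subr_gt0 // ltr1n.
have at0 : 0 < 1 - (a + t) by rewrite subr_gt0.
have [e e0 eP] := schur_agler_near phi_SA z0B t0 at1.
have N0 : 0 <= defect_ratio phi z0.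
  have [|_ [p1 _ _]] := eP [::] z0 isT.
    by rewrite subrr normr0 add0r /steps_norm big_nil.
  by rewrite divr_ge0 ?subr_ge0 ?expr_le1 // ltW.
pose A := n.-1`!%:R * ((sqrtC (defect_ratio phi z0) + t) / (1 - (a + t)) ^+ n.-1).
pose K : C := sqrtC (1 + 1 / (1 - (a + t) ^+ 2)).
have A0 : 0 <= A.
  apply: mulr_ge0 => //; apply: divr_ge0; last by rewrite exprn_ge0 // ltW.
  by rewrite addr_ge0 ?sqrtC_ge0 // ltW.
have K0 : 0 <= K.
  have at2 : 0 <= a + t by rewrite addr_ge0 // ltW.
  by rewrite sqrtC_ge0 addr_ge0 // divr_ge0 // subr_ge0 expr_le1 // ltW.
(* The added [1] covers [n = 0], where the quotient is [phi z] itself. *)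
exists e => //; exists (A * (n%:R * K) + 1); first by rewrite addr_ge0 // mulr_ge0 // mulr_ge0.
move=> s z sn s_neq0 sz; have [bnd [p1 z1 zr]] := eP s z s_neq0 sz.
case: (eqVneq s [::]) => [->|s_nil]; first by apply: le_trans p1 _; rewrite lerDr mulr_ge0 // mulr_ge0.
apply: le_trans (bnd s_nil) _; rewrite sn -/A.
have P0 : 0 <= 1 - `|phi z| ^+ 2 by rewrite subr_ge0 expr_le1.
apply: (@le_trans _ _ (1 * (A * (n%:R * K)))); last by rewrite mul1r lerDl.
have S0 : 0 <= \sum_(p <- s) sqrtC (1 + `|z 0 p.1| ^+ 2 / (1 - sqnorm z)).
  apply: sumr_ge0 => p _.
  by rewrite sqrtC_ge0 addr_ge0 // divr_ge0 ?exprn_ge0 // subr_ge0 ltW.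
apply: ler_pM; rewrite ?sqrtC_ge0 //; first by rewrite mulr_ge0.
  by rewrite -[leRHS]sqrtC1 ler_sqrtC ?qualifE //= gerBl exprn_ge0.
rewrite ler_wpM2l //.
apply: (@le_trans _ _ (\sum_(p <- s) K)); last first.
  by rewrite big_const_seq count_predT iter_addr_0 sn mulr_natl.
by apply: ler_sum => p _; exact: weight_bound.
Qed.

Lemma mixed_partialE (nu : 'I_d -> nat) z : mixed_partial nu phi z =
  foldl (fun g j => 'D_(delta_mx 0 j) g) phi (direction_word nu) z.
Proof. by rewrite foldl_direction_word. Qed.

End Final.

Theorem theorem10 (R : realType) (d : nat) (d_gt0 : (0 < d)%N)
    (phi : 'rV[Cplx R]_d -> Cplx R) (phi_SA : schur_agler phi)
    (z : 'rV[Cplx R]_d) (zB : unit_ball z)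
    (nu : 'I_d -> nat) (nu_neq0 : exists j : 'I_d, nu j <> 0%N) :
  let n := (\sum_(j < d) nu j)%N in
  `| mixed_partial nu phi z | <=
    (n.-1)`!%:R *
    ((1 - `|phi z| ^+ 2) / ((1 - norm2 z ^+ 2) * (1 - norm2 z) ^+ n.-1)) *
    \sum_(j < d) (nu j)%:R * sqrtC (1 - norm2 (hat z j) ^+ 2).
Proof.
cbv zeta; set n := (\sum_(j < d) nu j)%N.
have z1 : sqnorm z < 1 by move: zB; rewrite unit_ballE.
have norm2E w : norm2 w = sqrtC (sqnorm w) by rewrite /norm2 inner_sqnorm.
have hatE j : norm2 (hat z j) ^+ 2 = sqnorm z - `|z 0 j| ^+ 2.
  rewrite norm2E sqrtCK /sqnorm [in RHS](bigD1 j) //= [RHS]addrC addKr [LHS](bigD1 j) //=.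
  rewrite mxE eqxx normr0 expr0n add0r; apply: eq_bigr => k /negPf kj.
  by rewrite mxE kj.
have a1 : sqrtC (sqnorm z) < 1 by apply: sqrtC_lt1 => //; exact: sqnorm_ge0.
have e0 : 0 < 1 - sqrtC (sqnorm z) by rewrite subr_gt0.
(* For each fixed slack [t] the steps tend to zero, which bounds the derivative; only then does [t]
   tend to zero. *)
have bound t : 0 < t -> t < 1 - sqrtC (sqnorm z) ->
    [/\ `|phi z| <= 1, 0 <= defect_ratio phi z & `|mixed_partial nu phi z| <=
    limit_bound (sqrtC (1 - `|phi z| ^+ 2)) n.-1`!%:R (sqrtC (defect_ratio phi z))
    (sqrtC (sqnorm z))
    (\sum_j (nu j)%:R * sqrtC (1 + `|z 0 j| ^+ 2 / (1 - sqnorm z))) n.-1 t].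
  move=> t0; rewrite ltrBrDl => t1.
  have [e e_gt0 eP] := schur_agler_near phi_SA zB t0 t1.
  have [|_ [p1 _ _]] := eP [::] z isT.
    by rewrite subrr normr0 add0r /steps_norm big_nil.
  split=> //; first by rewrite divr_ge0 ?subr_ge0 ?expr_le1 // ltW.
  rewrite mixed_partialE.
  apply: (tame_iterated_bound (@complex_archimedean R) (@complex_complete R)
    (@unit_ball_open R d) (schur_agler_tame phi_SA) zB e_gt0).
  move=> s sw s_neq0 se.
  have ssz : size s = n by rewrite -(size_map fst) sw size_direction_word.
  have [|+ _] := eP s z s_neq0; first by rewrite subrr normr0 add0r.
  rewrite ssz (sum_steps _ (fun j => sqrtC (1 + `|z 0 j| ^+ 2 / (1 - sqnorm z)))).
  rewrite sw sum_direction_word; apply.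
  (* Some [nu j] is nonzero, so the list of steps is nonempty. *)
  rewrite -size_eq0 ssz -lt0n; have [j /eqP] := nu_neq0.
  by rewrite -lt0n => h; apply: leq_trans h _; rewrite /n (bigD1 j) //= leq_addr.
(* One admissible [t] suffices to extract the facts that do not depend on it. *)
have e2 : 0 < (1 - sqrtC (sqnorm z)) / 2 by rewrite divr_gt0.
have [|p1 r0 _] := bound _ e2; first by rewrite ltr_pdivrMr // ltr_pMr // ltr1n.
have P0 : 0 <= 1 - `|phi z| ^+ 2 by rewrite subr_ge0 expr_le1.
have T0 : 0 <= \sum_j (nu j)%:R * sqrtC (1 + `|z 0 j| ^+ 2 / (1 - sqnorm z)).
  apply: sumr_ge0 => j _; rewrite mulr_ge0 // sqrtC_ge0 addr_ge0 //.
  by rewrite divr_ge0 ?exprn_ge0 // subr_ge0 ltW.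
set S := sqrtC (1 - `|phi z| ^+ 2) in bound *; set T := \sum_j _ in bound T0 *.
set u := limit_bound _ _ _ _ _ _ in bound *.
have u_real t : 0 <= t -> t < 1 - sqrtC (sqnorm z) -> u t \is Num.real.
  move=> t0 te; apply: ger0_real; rewrite /u /limit_bound.
  rewrite mulr_ge0 ?sqrtC_ge0 // mulr_ge0 // mulr_ge0 //.
  rewrite divr_ge0 ?addr_ge0 ?sqrtC_ge0 // exprn_ge0 // subr_ge0.
  by rewrite -lerBrDl ltW.
have : `|mixed_partial nu phi z| <= u 0.
  apply: (@le_of_right_limit _ u _ _ _ e0).
  - exact: limit_bound_continuous.
  - exact: u_real.
  move=> t t0 te; have [_ _ le] := bound t t0 te; split=> //.
  by apply: u_real => //; exact: ltW.
rewrite /u limit_bound0 // norm2E sqrtCK => /le_trans; apply.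
rewrite le_eqVlt; apply/orP; left; apply/eqP; congr (_ * _).
by apply: eq_bigr => j _; rewrite hatE.
Qed.
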